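(* Let $\sigma>1$, and let $\psi\in C^\infty(\mathbb{R})$ be an orthonormal wavelet such that $\widehat{\psi}\in\mathcal{D}_\sigma(\mathbb{R})$ and $$\widehat{\psi}(\xi)=e^{i\xi/2}\,b_a(\xi),\qquad \xi\in\mathbb{R},$$ where $a\in(0,\pi/3)$ and $b_a$ is the even bell-shaped function described in the context. Then $\psi$ together with its derivatives satisfies the following estimates. (i) For every $n\in\mathbb{N}_0$ and every $h>0$ there exist $C>0$ and $R>1$ such that $$|\psi^{(n)}(x)|\le C\,\exp\left(-h\left(\frac{\ln^{\sigma}(|x|)}{W(\ln(|x|))}\right)^{\frac{1}{\sigma-1}}\right)\qquad\text{for all } |x|\ge R.$$ (ii) For every $h>0$ there exist $C>0$ and $R>1$ such that $$|\psi^{(n)}(x)|\le C^{n+1}\,n!^{\,s}\,\exp\left(-h\left(\frac{\ln^{\sigma}(|x|)}{W(\ln(|x|))}\right)^{\frac{1}{\sigma-1}}\right)$$ for every $0<s\le 1$, every $n\in\mathbb{N}_0$, and all $|x|\ge R$.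
   Context: Notation: $\mathbb{N}_0=\{0,1,2,\dots\}$; $\ln^{\sigma}(t)$ means $(\ln t)^{\sigma}$. $W:[0,\infty)\to[0,\infty)$ denotes the (principal branch of the) Lambert function, i.e. the inverse of $x\mapsto xe^x$ on $[0,\infty)$. Fourier transform: $\widehat f(\xi)=\int_{\mathbb{R}}f(x)e^{ix\xi}\,dx$ for $f\in L^1(\mathbb{R})$, extended to $L^2(\mathbb{R})$ in the standard way. Orthonormal wavelet: $\psi\in L^2(\mathbb{R})$ is an orthonormal wavelet if $\{\psi_{m,n}: m,n\in\mathbb{Z}\}$ is an orthonormal basis of $L^2(\mathbb{R})$, where $\psi_{m,n}(x)=2^{m/2}\psi(2^mx-n)$. Extended Gevrey classes: for $\tau>0$, $\sigma>1$ put $M^{\tau,\sigma}_0=1$ and $M^{\tau,\sigma}_p=p^{\tau p^\sigma}$ for $p\ge1$. The Roumieu class $\mathcal{E}_{\{\tau,\sigma\}}(\mathbb{R})$ is the set of $\phi\in C^\infty(\mathbb{R})$ such that for every compact $K\subset\mathbb{R}$ there are $C_K>0$ and $h>0$ with $|\phi^{(p)}(x)|\le C_K h^{p^\sigma}M^{\tau,\sigma}_p$ for all $x\in K$, $p\in\mathbb{N}_0$. The Beurling class $\mathcal{E}_{(\tau,\sigma)}(\mathbb{R})$ is the set of $\phi\in C^\infty(\mathbb{R})$ such that for every compact $K\subset\mathbb{R}$ and every $h>0$ there is $C_{K,h}>0$ with $|\phi^{(p)}(x)|\le C_{K,h}h^{p^\sigma}M^{\tau,\sigma}_p$ for all $x\in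 K$, $p\in\mathbb{N}_0$. $\mathcal{E}_{\tau,\sigma}(\mathbb{R})$ denotes either of these, $\mathcal{D}_{\tau,\sigma}(\mathbb{R})$ is the set of compactly supported functions in $\mathcal{E}_{\tau,\sigma}(\mathbb{R})$, and $\mathcal{D}_\sigma(\mathbb{R})=\bigcap_{\tau>0}\mathcal{D}_{\tau,\sigma}(\mathbb{R})$ (the Roumieu and Beurling versions give the same intersection). The function $b_a$: let $a\in(0,\pi/3)$. For $c\in\{a,2a\}$ let $\phi_c\in\mathcal{D}_\sigma(\mathbb{R})$ satisfy $\phi_c\ge0$, $\operatorname{supp}\phi_c\subset[-c,c]$ and $\int_{\mathbb{R}}\phi_c(x)\,dx=\pi/2$. Put $\theta_c(x)=\int_{-\infty}^x\phi_c(t)\,dt$, $S_c(x)=\sin(\theta_c(x))$, $C_c(x)=\cos(\theta_c(x))$. For $x\ge0$ set $b_a(x)=S_a(x-\pi)\,C_{2a}(x-2\pi)$, and extend $b_a$ to $(-\infty,0]$ as an even function. *)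

(* Defs.v *)
From HB Require Import structures.
From mathcomp Require Import all_boot all_order all_algebra.
From mathcomp Require Import all_classical all_reals all_analysis.
From mathcomp Require Import complex.

Set Implicit Arguments.
Unset Strict Implicit.
Unset Printing Implicit Defensive.
Import Order.TTheory GRing.Theory Num.Theory.
Import numFieldNormedType.Exports.

Local Open Scope classical_set_scope.
Local Open Scope ring_scope.
Local Open Scope complex_scope.

(* Functions of a real variable with values in R[i] are differentiated and
   integrated through their real and imaginary parts. The modulus is taken
   with the R-valued normc, since `|_| on R[i] is itself R[i]-valued. *)

Notation Rpart f := (fun x => complex.Re (f x)).
Notation Ipart f := (fun x => complex.Im (f x)).
Notation cmod := ComplexField.Normc.normc.

Definition cderiv (R : realType) (n : nat) (f : R -> R[i]) (x : R) : R[i] :=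
  (derive1n n (Rpart f) x) +i* (derive1n n (Ipart f) x).

Definition smooth (R : realType) (f : R -> R[i]) : Prop :=
  forall (n : nat) (x : R),
    derivable (derive1n n (Rpart f)) x 1 /\
    derivable (derive1n n (Ipart f)) x 1.

Definition supp (R : realType) (f : R -> R[i]) : set R :=
  closure [set x | f x != 0].

Definition cintegral (R : realType) (f : R -> R[i]) : R[i] :=
  (\int[lebesgue_measure]_(x in [set: R]) complex.Re (f x)) +i*
  (\int[lebesgue_measure]_(x in [set: R]) complex.Im (f x)).

Definition cexpi (R : realType) (t : R) : R[i] := cos t +i* sin t.

Definition in_Lp (R : realType) (p : \bar R) (f : R -> R[i]) : Prop :=
  (Rpart f \in Lfun lebesgue_measure p) /\
  (Ipart f \in Lfun lebesgue_measure p).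

Definition L2dist (R : realType) (f g : R -> R[i]) : \bar R :=
  Lnorm lebesgue_measure 2%:E (fun x => (cmod (f x - g x))%:E).

Definition fourier (R : realType) (f : R -> R[i]) (xi : R) : R[i] :=
  cintegral (fun x => f x * cexpi (x * xi)).

(* The graph of the continuous extension of the Fourier transform from
   L1 /\ L2 to L2, i.e. the closure in L2 x L2 of the graph on L1 /\ L2. It
   determines g up to a null set only. *)
Definition is_fourier_L2 (R : realType) (f g : R -> R[i]) : Prop :=
  [/\ in_Lp 2%:E f, in_Lp 2%:E g &
    exists u : nat -> R -> R[i],
      [/\ forall k, in_Lp 1%:E (u k),
          forall k, in_Lp 2%:E (u k),
          L2dist (u k) f @[k --> \oo] --> 0%E &
          L2dist (fourier (u k)) g @[k --> \oo] --> 0%E]].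

Definition L2inner (R : realType) (f g : R -> R[i]) : R[i] :=
  cintegral (fun x => f x * (g x)^*).

Definition orthonormal_basis_L2 (R : realType) (I : eqType)
    (e : I -> R -> R[i]) : Prop :=
  [/\ forall i, in_Lp 2%:E (e i),
      forall i j, L2inner (e i) (e j) = (i == j)%:R &
      forall (f : R -> R[i]) (eps : R), in_Lp 2%:E f -> 0 < eps ->
        exists (s : seq I) (c : I -> R[i]),
          (L2dist f (fun x => (\sum_(i <- s) c i * e i x)%R)
             < eps%:E)%E].

Definition dilate (R : realType) (psi : R -> R[i]) (mn : int * int) (x : R)
    : R[i] :=
  ((2 : R) `^ (mn.1%:~R / 2))%:C * psi ((2 : R) ^ mn.1 * x - mn.2%:~R).

Definition orthonormal_wavelet (R : realType) (psi : R -> R[i]) : Prop :=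
  in_Lp 2%:E psi /\ orthonormal_basis_L2 (dilate psi).

Definition Mseq (R : realType) (tau sigma : R) (p : nat) : R :=
  if p == 0%N then 1 else p%:R `^ (tau * p%:R `^ sigma).

Definition gevrey_roumieu (R : realType) (tau sigma : R) (phi : R -> R[i])
    : Prop :=
  smooth phi /\
  forall K : set R, compact K ->
    exists C h : R, [/\ 0 < C, 0 < h &
      forall (x : R) (p : nat), K x ->
        cmod (cderiv p phi x) <= C * h `^ (p%:R `^ sigma) * Mseq tau sigma p].

Definition gevrey_beurling (R : realType) (tau sigma : R) (phi : R -> R[i])
    : Prop :=
  smooth phi /\
  forall (K : set R) (h : R), compact K -> 0 < h ->
    exists C : R, 0 < C /\
      forall (x : R) (p : nat), K x ->
        cmod (cderiv p phi x) <= C * h `^ (p%:R `^ sigma) * Mseq tau sigma p.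

Definition D_roumieu (R : realType) (tau sigma : R) (phi : R -> R[i]) : Prop :=
  gevrey_roumieu tau sigma phi /\ compact (supp phi).

Definition D_beurling (R : realType) (tau sigma : R) (phi : R -> R[i])
    : Prop :=
  gevrey_beurling tau sigma phi /\ compact (supp phi).

(* The Beurling classes have the same intersection, see D_sigma_beurling. *)
Definition D_sigma (R : realType) (sigma : R) (phi : R -> R[i]) : Prop :=
  forall tau : R, 0 < tau -> D_roumieu tau sigma phi.

(* Given y < 0, which has no preimage in [0, +oo[, it returns 0. *)
Definition lambertW (R : realType) (y : R) : R :=
  xget 0 [set w | 0 <= w /\ w * expR w = y].

Definition phi_admissible (R : realType) (sigma c : R) (phi : R -> R) : Prop :=
  [/\ D_sigma sigma (fun x => (phi x)%:C),
      forall x, 0 <= phi x,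
      supp (fun x => (phi x)%:C) `<=` `[- c, c] &
      \int[lebesgue_measure]_(x in [set: R]) phi x = pi / 2].

Definition theta (R : realType) (phi : R -> R) (x : R) : R :=
  \int[lebesgue_measure]_(t in `]-oo, x]) phi t.

Definition bell (R : realType) (phia phi2a : R -> R) (x : R) : R :=
  let b (y : R) := sin (theta phia (y - pi)) * cos (theta phi2a (y - 2 * pi)) in
  if 0 <= x then b x else b (- x).

Definition decay (R : realType) (sigma h x : R) : R :=
  expR (- h * ((ln `|x|) `^ sigma / lambertW (ln `|x|)) `^ (1 / (sigma - 1))).

Lemma xexp_inj (R : realType) (x y : R) : 0 <= x -> 0 <= y ->
  x * expR x = y * expR y -> x = y.
Proof.
move=> x0 y0 e; apply/eqP; rewrite eq_le; apply/andP; split; rewrite leNgt.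
  apply/negP => yx; have : y * expR y < x * expR x.
    by apply: (le_lt_trans (y := y * expR x));
      rewrite ?ler_wpM2l ?ler_expR ?(ltW yx) ?ltr_pM2r ?expR_gt0.
  by rewrite e ltxx.
apply/negP => xy; have : x * expR x < y * expR y.
  by apply: (le_lt_trans (y := x * expR y));
    rewrite ?ler_wpM2l ?ler_expR ?(ltW xy) ?ltr_pM2r ?expR_gt0.
by rewrite e ltxx.
Qed.

Lemma lambertWP (R : realType) (y : R) : 0 <= y ->
  0 <= lambertW y /\ lambertW y * expR (lambertW y) = y.
Proof.
move=> y0; rewrite /lambertW.
suff [w ?] : exists w, [set w | 0 <= w /\ w * expR w = y] w.
  by case: xgetP => [v -> //|/(_ w)].
have [||w + wy] := @IVT R (fun w => w * expR w) 0 y y y0.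
- apply: continuous_subspaceT => x.
  by apply: cvgM; [exact: cvg_id|exact: continuous_expR].
- rewrite mul0r; apply/andP; split.
    by rewrite ge_min y0.
  by rewrite le_max ler_peMr ?orbT// -expR0 ler_expR.
- by rewrite in_itv/= => /andP[w0 _]; exists w.
Qed.

Lemma lambertWK (R : realType) (x : R) : 0 <= x -> lambertW (x * expR x) = x.
Proof.
move=> x0; have xe0 : 0 <= x * expR x by rewrite mulr_ge0// expR_ge0.
by have [w0 e] := lambertWP xe0; exact: xexp_inj e.
Qed.

Lemma powh_le_Mseq (R : realType) (tau sigma h h' : R) :
  0 < tau -> 1 < sigma -> 0 < h -> 0 < h' ->
  exists A : R, 0 < A /\ forall p : nat,
    h `^ (p%:R `^ sigma) * Mseq (tau / 2) sigma p <=
    A * (h' `^ (p%:R `^ sigma) * Mseq tau sigma p).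
Proof.
move=> t0 s1 h0 h'0.
have M0 (t : R) p : 0 < Mseq t sigma p.
  by rewrite /Mseq; case: eqP => // /eqP p0; rewrite powR_gt0// ltr0n lt0n.
pose q p := (h `^ (p%:R `^ sigma) * Mseq (tau / 2) sigma p) /
            (h' `^ (p%:R `^ sigma) * Mseq tau sigma p).
have D0 p : 0 < h' `^ (p%:R `^ sigma) * Mseq tau sigma p.
  by rewrite mulr_gt0// powR_gt0.
have q0 p : 0 < q p by rewrite divr_gt0// mulr_gt0// powR_gt0.
have [N hN] : exists N : nat, (h / h') `^ (2 / tau) < N%:R.
  by exists (Num.bound ((h / h') `^ (2 / tau))); rewrite archi_boundP// powR_ge0.
have S0 : 0 <= \sum_(p < N.+1) q p by apply: sumr_ge0 => i _; rewrite ltW.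
exists (1 + \sum_(p < N.+1) q p); split; first by rewrite ltr_pwDl.
move=> p; rewrite -ler_pdivrMr//.
have [pN|Np] := ltnP p N.+1.
  rewrite (bigD1 (Ordinal pN))//= addrCA lerDl addr_ge0//.
  by apply: sumr_ge0 => i _; rewrite ltW.
apply: (@le_trans _ _ 1); last by rewrite lerDl.
rewrite ler_pdivrMr// mul1r.
have p0 : (0 < p)%N by apply: leq_ltn_trans Np.
have pR0 : 0 < p%:R :> R by rewrite ltr0n.
rewrite /Mseq gtn_eqF//.
set P := p%:R `^ sigma.
have P0 : 0 <= P by rewrite powR_ge0.
have -> : tau * P = tau / 2 * P + tau / 2 * P by rewrite -mulrDl -splitr.
rewrite powRD; last by rewrite (gt_eqF pR0) implybT.
rewrite mulrA ler_pM2r ?powR_gt0//.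
rewrite powRrM -powRM ?powR_ge0 ?(ltW h'0)//.
apply: ge0_ler_powR => //; rewrite ?nnegrE ?(ltW h0) ?mulr_ge0 ?powR_ge0 ?(ltW h'0)//.
rewrite mulrC -ler_pdivrMr//.
have -> : h / h' = ((h / h') `^ (2 / tau)) `^ (tau / 2).
  rewrite -powRrM mulrA divfK ?gt_eqF// divff ?pnatr_eq0// powRr1//.
  by rewrite divr_ge0 ?ltW.
apply: ge0_ler_powR; rewrite ?nnegrE ?powR_ge0 ?divr_ge0 ?(ltW t0) ?(ltW pR0)//.
by apply: ltW; apply: lt_le_trans hN _; rewrite ler_nat ltnW.
Qed.

Lemma D_sigma_beurling (R : realType) (sigma : R) (phi : R -> R[i]) :
  1 < sigma ->
  D_sigma sigma phi <-> (forall tau : R, 0 < tau -> D_beurling tau sigma phi).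
Proof.
move=> s1; split=> H tau t0; last first.
  have [[sm B] cs] := H tau t0; split=> //; split=> // K cK.
  by have [C [C0 HC]] := B K 1 cK ltr01; exists C, 1.
have t20 : 0 < tau / 2 by rewrite divr_gt0// ltr0n.
have [[sm B] cs] := H _ t20; split=> //.
split=> // K h cK h0; have [C [k [C0 k0 HC]]] := B K cK.
have [A [A0 HA]] := powh_le_Mseq t0 s1 k0 h0.
exists (C * A); split; first by rewrite mulr_gt0.
move=> x p Kx; apply: le_trans (HC x p Kx) _.
by rewrite -!mulrA ler_pM2l.
Qed.

(* Main.v *)
(** The wavelet is recovered from its transform by Fourier inversion, and a
    compactly supported function of an extended Gevrey class has a transform
    that decays like [inf_k k! h^(k^sigma) M_k / |x|^k].

    - Inversion: pairing the transform with [exp(- e |xi|) exp(- i y xi)] turns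
      it into the Poisson integral [int f(x) 2 e / (e^2 + (x - y)^2) dx], first
      for integrable functions by Fubini, then in L2 by Hoelder. Letting [e]
      tend to 0 gives the inversion formula at points of continuity of [f].
    - Derivatives: differentiating [psi] multiplies the transform by [xi],
      multiplying [psi] by [x] differentiates it. A sequence [A] with
      [(n + 1) A_n <= A_(n+1)] has the property that [c (L + 1) A] bounds the
      derivatives of [xi F(xi)] whenever [F] is supported in [[-L, L]] and [c A]
      bounds its derivatives, so [n] derivatives cost a factor [(L + 1)^n].
    - Optimisation: with [l = ln |x|] and [w = W(l)] one has [l / w = e^w], and
      [k ~ 4 H e^(w / (sigma - 1))] makes the infimum at most [exp(- H l^(sigma /
      (sigma - 1)) w^(-1 / (sigma - 1)))] when [tau] is small and [|x|] large. *)

Require Import Defs.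
From HB Require Import structures.
From mathcomp Require Import all_boot all_order all_algebra.
From mathcomp Require Import all_classical all_reals all_analysis.
From mathcomp Require Import measurable_realfun complex.
From mathcomp Require Import ring lra.

Set Implicit Arguments.
Unset Strict Implicit.
Unset Printing Implicit Defensive.

Import Order.TTheory GRing.Theory Num.Theory.
Import numFieldNormedType.Exports.

Local Open Scope classical_set_scope.
Local Open Scope ring_scope.
Local Open Scope complex_scope.

(** * The exponential kernel and the Poisson kernel *)

Section Kernels.
Context {R : realType}.
Implicit Types (e t x y : R).
Local Notation mu := (@lebesgue_measure R).

(** Folding the negative half-line onto the positive one makes the fundamental theorem on [[0, +oo[]
    applicable to integrals over the whole line. *)
Lemma ge0_integral_reflect (f : R -> R) : (forall x, 0 <= f x) ->
  continuous f ->
  (\int[mu]_x (f x)%:E = \int[mu]_(x in `[0%R, +oo[) (f x)%:E +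
                         \int[mu]_(x in `[0%R, +oo[) (f (- x))%:E)%E.
Proof.
move=> f0 cf.
have mf : measurable_fun [set: R] f by exact: continuous_measurable_fun.
rewrite -(setUv (`[0%R, +oo[ : set R)) ge0_integral_setU//=; last 4 first.
- exact: measurableC.
- by apply/measurable_EFinP; rewrite setUv.
- by move=> x _; rewrite lee_fin.
- exact/disj_setPCl.
congr +%E.
rewrite setCitvr integral_itv_bndo_bndc; last exact/measurable_EFinP/measurable_funTS.
rewrite -{1}oppr0 ge0_integration_by_substitutionNy//.
exact: continuous_subspaceT.
Qed.

Lemma ge0_integral_opp (f : R -> R) : (forall x, 0 <= f x) ->
  continuous f -> (\int[mu]_x (f x)%:E = \int[mu]_x (f (- x))%:E)%E.
Proof.
move=> f0 cf; rewrite ge0_integral_reflect// [RHS]ge0_integral_reflect//.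
  by under [X in (_ = _ + X)%E]eq_integral do rewrite opprK; rewrite addeC.
move=> x; apply: (continuous_comp (f := -%R) (g := f)); last exact: cf.
exact: oppr_continuous.
Qed.

(** The Abel damping factor of the inversion argument; it tends to 1 as [e] tends to 0. *)
Definition expabs e x : R := expR (- (e * `|x|)).

Lemma expabs_gt0 e x : 0 < expabs e x. Proof. exact: expR_gt0. Qed.

Lemma expabs_le1 e x : 0 <= e -> expabs e x <= 1.
Proof. by move=> e0; rewrite /expabs -expR0 ler_expR oppr_le0 mulr_ge0. Qed.

Lemma continuous_expabs e : continuous (expabs e).
Proof.
move=> x; apply: continuous_comp; last exact: continuous_expR.
apply: cvgN; apply: cvgM; first exact: cvg_cst.
exact: norm_continuous.
Qed.

Lemma expabsN e x : expabs e (- x) = expabs e x.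
Proof. by rewrite /expabs normrN. Qed.

(** The cosine transform of [expabs e]: the Poisson kernel of the half-plane scaled to total mass 2
    pi. *)
Definition poisson e t : R := 2 * e / (e ^+ 2 + t ^+ 2).

Lemma poisson_gt0 e t : 0 < e -> 0 < poisson e t.
Proof.
move=> e0; rewrite /poisson divr_gt0 ?mulr_gt0//.
by rewrite ltr_pwDl ?exprn_gt0 ?sqr_ge0.
Qed.

Lemma continuous_poisson e : 0 < e -> continuous (poisson e).
Proof.
move=> e0 x; apply: cvgM; first exact: cvg_cst.
apply: cvgV; first by rewrite gt_eqF// ltr_pwDl ?exprn_gt0 ?sqr_ge0.
by apply: cvgD; [exact: cvg_cst|exact: exprn_continuous].
Qed.

Lemma poisson_le e t : 0 < e -> poisson e t <= 2 / e.
Proof.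
move=> e0; have ee : 0 < e ^+ 2 by rewrite exprn_gt0.
have te : 0 <= t ^+ 2 by rewrite sqr_ge0.
rewrite /poisson ler_pdivrMr; last by lra.
rewrite mulrAC ler_pdivlMr//.
have : 0 <= 2 * t ^+ 2 by lra.
nra.
Qed.

Lemma cvgy_expRN e : 0 < e -> (fun x : R => expR (- (e * x))) x @[x --> +oo] --> (0 : R).
Proof.
move=> e0; apply: (cvg_comp (fun x => e * x) (fun x => expR (- x))).
  by apply: gt0_cvgMry => //; exact: cvg_id.
exact: cvgr_expR.
Qed.

Lemma integral_expabs e : 0 < e -> (\int[mu]_x (expabs e x)%:E = (2 / e)%:E)%E.
Proof.
move=> e0; rewrite ge0_integral_reflect//; last 2 first.
- by move=> x; rewrite ltW// expabs_gt0.
- exact: continuous_expabs.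
under [X in (_ + X)%E]eq_integral do rewrite expabsN.
suff -> : (\int[mu]_(x in `[0%R, +oo[) (expabs e x)%:E = (e^-1)%:E)%E.
  by rewrite -EFinD; congr EFin; field; rewrite gt_eqF.
rewrite (@ge0_continuous_FTC2y _ _ (fun x => - (e^-1 * expR (- (e * x)))) 0 0).
- by rewrite mulr0 oppr0 expR0 mulr1 EFinN oppeK add0e.
- by move=> x _; rewrite ltW// expabs_gt0.
- by apply: continuous_subspaceT; exact: continuous_expabs.
- rewrite -oppr0; apply: cvgN; rewrite -(mulr0 e^-1).
  by apply: cvgM; [exact: cvg_cst|exact: cvgy_expRN].
- move=> x _; exact: ex_derive.
- apply: cvg_at_right_filter; apply: cvgN; apply: cvgM; first exact: cvg_cst.
  apply: continuous_comp; last exact: continuous_expR.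
  by apply: cvgN; apply: cvgM; [exact: cvg_cst|exact: cvg_id].
- move=> x; rewrite in_itv/= andbT => x0; rewrite derive1E derive_val.
  rewrite /expabs gtr0_norm//.
  rewrite /GRing.scale/=.
  have en : e != 0 by rewrite gt_eqF.
  by field.
Qed.

Lemma integrable_expabs e : 0 < e -> mu.-integrable [set: R] (EFin \o expabs e).
Proof.
move=> e0; apply/integrableP; split.
  by apply/measurable_EFinP; apply: continuous_measurable_fun; exact: continuous_expabs.
under eq_integral do rewrite /= gtr0_norm ?expabs_gt0//.
by rewrite integral_expabs// ltry.
Qed.

Lemma continuous_cosM t : continuous (fun x : R => cos (t * x)).
Proof.
move=> x; apply: continuous_comp; last exact: continuous_cos.
by apply: cvgM; [exact: cvg_cst|exact: cvg_id].
Qed.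

Lemma continuous_sinM t : continuous (fun x : R => sin (t * x)).
Proof.
move=> x; apply: continuous_comp; last exact: continuous_sin.
by apply: cvgM; [exact: cvg_cst|exact: cvg_id].
Qed.

Lemma integrable_expabsM e (f : R -> R) : 0 < e -> measurable_fun setT f ->
  (forall x, `|f x| <= 1) ->
  mu.-integrable [set: R] (EFin \o (fun x => expabs e x * f x)).
Proof.
move=> e0 mf f1; apply: (le_integrable _ _ _ (integrable_expabs e0)) => //.
- apply/measurable_EFinP; apply: measurable_funM => //.
  apply: continuous_measurable_fun; exact: continuous_expabs.
- move=> x _; rewrite lee_fin normrM ler_piMr//.
Qed.

Lemma integrable_expabs_cos e t : 0 < e ->
  mu.-integrable [set: R] (EFin \o (fun x => expabs e x * cos (t * x))).
Proof.
move=> e0; apply: integrable_expabsM => // [|x]; last exact: cos_max.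
by apply: continuous_measurable_fun; exact: continuous_cosM.
Qed.

Lemma integrable_expabs_sin e t : 0 < e ->
  mu.-integrable [set: R] (EFin \o (fun x => expabs e x * sin (t * x))).
Proof.
move=> e0; apply: integrable_expabsM => // [|x]; last exact: sin_max.
by apply: continuous_measurable_fun; exact: continuous_sinM.
Qed.

Lemma Rintegral_expabs e : 0 < e -> \int[mu]_x expabs e x = 2 / e.
Proof. by move=> e0; rewrite /Rintegral integral_expabs. Qed.

(* The integrand is made nonnegative by adding 1 to the cosine, so that the
   fundamental theorem on a half-line applies. *)
Lemma integral_expabs_1Dcos e t : 0 < e ->
  (\int[mu]_x (expabs e x * (1 + cos (t * x)))%:E = (2 / e + poisson e t)%:E)%E.
Proof.
move=> e0.
have en : e != 0 by rewrite gt_eqF.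
have den : e ^+ 2 + t ^+ 2 != 0 by rewrite gt_eqF// ltr_pwDl ?exprn_gt0 ?sqr_ge0.
have cf : continuous (fun x => expabs e x * (1 + cos (t * x))).
  move=> x; apply: cvgM; first exact: continuous_expabs.
  by apply: cvgD; [exact: cvg_cst|exact: continuous_cosM].
have f0 x : 0 <= expabs e x * (1 + cos (t * x)).
  apply: mulr_ge0; first exact/ltW/expabs_gt0.
  by have := cos_geN1 (t * x); lra.
rewrite ge0_integral_reflect//.
under [X in (_ + X)%E]eq_integral do rewrite expabsN mulrN cosN.
(* An antiderivative on the positive half-line: the first term belongs to exp(- e x), the second to
   exp(- e x) cos(t x). Both vanish at infinity, so the integral is - F(0). *)
pose F x := - (e^-1 * expR (- (e * x))) +
  expR (- (e * x)) * (t * sin (t * x) - e * cos (t * x)) / (e ^+ 2 + t ^+ 2).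
suff -> : (\int[mu]_(x in `[0%R, +oo[) (expabs e x * (1 + cos (t * x)))%:E =
  (e^-1 + e / (e ^+ 2 + t ^+ 2))%:E)%E.
  by rewrite -EFinD; congr EFin; rewrite /poisson; field; rewrite en den.
rewrite (@ge0_continuous_FTC2y _ _ F 0 0).
- rewrite /F !mulr0 oppr0 expR0 mulr1 sin0 cos0 mulr0 sub0r -EFinB sub0r; congr EFin.
  by field; rewrite en den.
- by move=> x _; exact: f0.
- exact/continuous_subspaceT.
- rewrite /F -[X in _ --> X]addr0; apply: cvgD.
    rewrite -oppr0; apply: cvgN; rewrite -(mulr0 e^-1).
    by apply: cvgM; [exact: cvg_cst|exact: cvgy_expRN].
  rewrite -(mul0r ((e ^+ 2 + t ^+ 2)^-1)); apply: cvgM; last exact: cvg_cst.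
  apply: (@squeeze_cvgr _ _ _ _ (fun x => - ((`|t| + e) * expR (- (e * x))))
                                (fun x => (`|t| + e) * expR (- (e * x)))).
  + apply: nearW => x; rewrite -ler_norml normrM [leLHS]mulrC (gtr0_norm (expR_gt0 _)).
    rewrite ler_pM2r ?expR_gt0//; apply: (le_trans (ler_normB _ _)).
    rewrite !normrM (gtr0_norm e0) lerD//.
      by rewrite ler_piMr// sin_max.
    by rewrite ler_piMr ?(ltW e0)// cos_max.
  + rewrite -oppr0; apply: cvgN; rewrite -(mulr0 (`|t| + e)).
    by apply: cvgM; [exact: cvg_cst|exact: cvgy_expRN].
  + rewrite -(mulr0 (`|t| + e)).
    by apply: cvgM; [exact: cvg_cst|exact: cvgy_expRN].
- move=> x _; exact: ex_derive.
- apply: cvg_at_right_filter.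
  have /derivable1_diffP/differentiable_continuous : derivable F 0 1 by exact: ex_derive.
  exact.
- move=> x; rewrite in_itv/= andbT => x0; rewrite derive1E derive_val.
  rewrite /expabs gtr0_norm// /GRing.scale/=.
  by field; rewrite en den.
Qed.

Lemma Rintegral_expabs_cos e t : 0 < e ->
  \int[mu]_x (expabs e x * cos (t * x)) = poisson e t.
Proof.
move=> e0; have := integral_expabs_1Dcos t e0.
under eq_integral do rewrite mulrDr mulr1.
move=> /(congr1 fine).
rewrite -[LHS]/(\int[mu]_x (expabs e x + expabs e x * cos (t * x))).
rewrite RintegralD//; last 2 first.
- exact: integrable_expabs.
- exact: integrable_expabs_cos.
by rewrite Rintegral_expabs//= => /addrI.
Qed.

(** The integrand is odd. Reflection is available for nonnegative functions, hence the 1 added to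
    the sine; after cancelling it the integral equals its own opposite. *)
Lemma Rintegral_expabs_sin e t : 0 < e ->
  \int[mu]_x (expabs e x * sin (t * x)) = 0.
Proof.
move=> e0.
have cf : continuous (fun x => expabs e x * (1 + sin (t * x))).
  move=> x; apply: cvgM; first exact: continuous_expabs.
  by apply: cvgD; [exact: cvg_cst|exact: continuous_sinM].
have f0 x : 0 <= expabs e x * (1 + sin (t * x)).
  apply: mulr_ge0; first exact/ltW/expabs_gt0.
  by have := sin_geN1 (t * x); lra.
have := ge0_integral_opp f0 cf.
under [X in _ = X]eq_integral do rewrite expabsN mulrN sinN mulrDr mulr1 mulrN.
under [X in X = _]eq_integral do rewrite mulrDr mulr1.
move=> /(congr1 fine).
rewrite -[LHS]/(\int[mu]_x (expabs e x + expabs e x * sin (t * x))).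
rewrite -[RHS]/(\int[mu]_x (expabs e x - expabs e x * sin (t * x))).
rewrite RintegralD ?RintegralB//;
  try exact: integrable_expabs_sin; try exact: integrable_expabs.
lra.
Qed.

(** The substitution u = (x - y) / e turns the kernel into 2 / (1 + u^2), whose integral over each
    half-line is pi. *)
Lemma integral_poisson e y : 0 < e ->
  (\int[mu]_x (poisson e (x - y))%:E = (2 * pi)%:E)%E.
Proof.
move=> e0.
pose F x : R := (x - y) * e^-1.
pose G := fun x : R => 2 * (oneDsqr x)^-1.
have en : e != 0 by rewrite gt_eqF.
have F'E : F^`()%classic = cst e^-1.
  apply/funext => x; rewrite derive1E derive_val.
  by rewrite /GRing.scale/=; ring.
have cG : continuous G.
  by move=> x; apply: cvgM; [exact: cvg_cst|exact: continuous_oneDsqrV].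
have G0 x : 0 <= G x by rewrite mulr_ge0// invr_ge0.
transitivity (\int[mu]_x (((G \o F) * F^`()%classic) x)%:E)%E.
  apply: eq_integral => x _; rewrite F'E/= /G /F /oneDsqr /poisson; congr EFin.
  rewrite fctE/=.
  field.
  by rewrite en/= gt_eqF// ltr_pwDl ?exprn_gt0 ?sqr_ge0.
rewrite -increasing_ge0_integration_by_substitutionT//.
- rewrite ge0_integral_reflect//.
  under [X in (_ + X)%E]eq_integral do rewrite /G /oneDsqr sqrrN -/(oneDsqr _) -/(G _).
  suff -> : (\int[mu]_(x in `[0%R, +oo[) (G x)%:E = pi%:E)%E.
    by rewrite -EFinD; congr EFin; ring.
  rewrite /G; under eq_integral do rewrite EFinM.
  rewrite ge0_integralZl//.
  + rewrite integral0y_oneDsqr -EFinM; congr EFin; by field.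
  + apply/measurable_EFinP/measurable_funTS.
    by apply: continuous_measurable_fun; exact: continuous_oneDsqrV.
- by move=> u v uv; rewrite /F ltr_pM2r ?invr_gt0// ltrD2r.
- by rewrite F'E => ?; exact: cvg_cst.
- by rewrite F'E; exact: is_cvg_cst.
- by rewrite F'E; exact: is_cvg_cst.
- by apply/gt0_cvgMlNy; [rewrite invr_gt0|exact: cvg_addrr_Ny].
- by apply/gt0_cvgMly; [rewrite invr_gt0|exact: cvg_addrr].
Qed.

Lemma integrable_poisson e y : 0 < e ->
  mu.-integrable [set: R] (EFin \o (fun x => poisson e (x - y))).
Proof.
move=> e0; apply/integrableP; split.
  apply/measurable_EFinP; apply: measurableT_comp => //.
    by apply: continuous_measurable_fun; exact: continuous_poisson.
  exact: measurable_funB.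
under eq_integral do rewrite /= gtr0_norm ?poisson_gt0//.
by rewrite integral_poisson// ltry.
Qed.

Lemma Rintegral_poisson e y : 0 < e -> \int[mu]_x poisson e (x - y) = 2 * pi.
Proof. by move=> e0; rewrite /Rintegral integral_poisson. Qed.

End Kernels.

(** * Inversion of the Fourier transform on L2 *)

Section L2pairing.
Context {R : realType}.
Local Notation mu := (@lebesgue_measure R).
Local Notation N2 f := (Lnorm mu 2%:E (EFin \o f)).

(** Since |phi|^2 <= C |phi|, a bounded integrable function is square integrable; this serves for
    the damped trigonometric functions and for the Poisson kernel. *)
Lemma bounded_integrable_Lnorm2 (phi : R -> R) (C : R) :
  mu.-integrable [set: R] (EFin \o phi) -> (forall x, `|phi x| <= C) ->
  (N2 phi < +oo)%E.
Proof.
move=> iphi phiC.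
have mphi : measurable_fun setT phi by apply/measurable_EFinP; exact: measurable_int iphi.
rewrite unlock; apply: poweR_lty.
have /integrableP[_] := integrableZl measurableT C iphi.
apply: le_lt_trans; apply: ge0_le_integral => //=.
- apply/measurable_EFinP.
  apply: (@measurableT_comp _ _ _ _ _ _ (fun x => x `^ 2)) => //.
  exact: measurableT_comp.
- apply/measurable_EFinP; apply: measurableT_comp => //.
  exact: measurable_funM.
- move=> x _; rewrite lee_fin powR_mulrn// expr2 normrM.
  by rewrite ler_wpM2r// (le_trans (phiC x))// ler_norm.
Qed.

Lemma integral_hoelder2 (v phi : R -> R) :
  measurable_fun setT v -> measurable_fun setT phi ->
  (\int[mu]_x `|(v x * phi x)%:E| <= N2 v * N2 phi)%E.
Proof.
move=> mv mphi; rewrite -[leLHS]Lnorm1.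
have := @hoelder _ _ _ mu v phi 2 2 mv mphi.
by apply => //; rewrite [RHS]splitr !div1r.
Qed.

Lemma integrable_mulL2 (v phi : R -> R) :
  measurable_fun setT v -> measurable_fun setT phi ->
  (N2 v < +oo)%E -> (N2 phi < +oo)%E ->
  mu.-integrable [set: R] (EFin \o (fun x => v x * phi x)).
Proof.
move=> mv mphi Nv Nphi; apply/integrableP; split.
  by apply/measurable_EFinP; exact: measurable_funM.
apply: (le_lt_trans (integral_hoelder2 mv mphi)).
apply: lte_mul_pinfty; [exact: Lnorm_ge0| |exact: Nphi].
by rewrite ge0_fin_numE ?Lnorm_ge0.
Qed.

(** By Hoelder the two pairings differ by at most the L2 norm of [u k - v] times that of [phi]. *)
Lemma cvg_Rintegral_mulL2 (u : nat -> R -> R) (v phi : R -> R) :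
  (forall k, measurable_fun setT (u k)) -> measurable_fun setT v ->
  measurable_fun setT phi ->
  (N2 phi < +oo)%E ->
  (forall k, mu.-integrable [set: R] (EFin \o (fun x => u k x * phi x))) ->
  mu.-integrable [set: R] (EFin \o (fun x => v x * phi x)) ->
  N2 (fun x => u k x - v x) @[k --> \oo] --> 0%E ->
  \int[mu]_x (u k x * phi x) @[k --> \oo] --> \int[mu]_x (v x * phi x).
Proof.
move=> muk mv mphi Nphi iu iv uv.
apply/cvgrPdist_le => eps eps0.
pose c := fine (N2 phi).
have c0 : 0 <= c by rewrite fine_ge0 ?Lnorm_ge0.
have cE : N2 phi = c%:E by rewrite fineK ?ge0_fin_numE ?Lnorm_ge0.
(* The + 1 covers the case where [phi] has norm 0. *)
have d0 : 0 < eps / (c + 1) by rewrite divr_gt0// ltr_wpDl.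
have [fnum /cvgr_lt/(_ _ d0) small] := (fine_cvgP _ _).1 uv.
near=> k.
have fk : N2 (fun x => u k x - v x) \is a fin_num by near: k.
have sk : fine (N2 (fun x => u k x - v x)) < eps / (c + 1) by near: k.
rewrite distrC -RintegralB//.
have iB : mu.-integrable [set: R] (EFin \o (fun x => (u k x - v x) * phi x)).
  apply: eq_integrable (integrableB measurableT (iu k) iv) => // x _ /=.
  by rewrite mulrBl.
under eq_Rintegral do rewrite -mulrBl.
rewrite -lee_fin EFin_normr_Rintegral//.
apply: (le_trans (le_abse_integral _ _ _)) => //; first exact: measurable_int iB.
apply: (le_trans (integral_hoelder2 _ _)) => //; first exact: measurable_funB.
rewrite cE -(fineK fk) -EFinM lee_fin.
apply: (@le_trans _ _ (eps / (c + 1) * c)); first by rewrite ler_wpM2r// ltW.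
by rewrite mulrAC ler_pdivrMr ?ltr_wpDl// ler_pM2l// lerDl.
Unshelve. all: by end_near.
Qed.

End L2pairing.

(** * The damped transform of an integrable function as a Poisson integral *)

Section FourierPoisson.
Context {R : realType}.
Local Notation mu := (@lebesgue_measure R).
Variables (p q : R -> R).
Hypotheses (ip : mu.-integrable [set: R] (EFin \o p))
           (iq : mu.-integrable [set: R] (EFin \o q)).

Let mp : measurable_fun setT p.
Proof. by apply/measurable_EFinP; exact: measurable_int ip. Qed.

Let mq : measurable_fun setT q.
Proof. by apply/measurable_EFinP; exact: measurable_int iq. Qed.

(** With z = (x, xi), the real part of (p + i q)(x) exp(i (x - y) xi) exp(- e |xi|). *)
Let ker (e y : R) (z : R * R) : R :=
  (p z.1 * cos ((z.1 - y) * z.2) - q z.1 * sin ((z.1 - y) * z.2)) * expabs e z.2.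

Let measurable_ker e y : measurable_fun setT (ker e y).
Proof.
have mc : measurable_fun setT (fun z : R * R => (z.1 - y) * z.2).
  apply: measurable_funM; last exact: measurable_snd.
  by apply: measurable_funB => //; exact: measurable_fst.
apply: measurable_funM; last first.
  apply: measurableT_comp; last exact: measurable_snd.
  by apply: continuous_measurable_fun; exact: continuous_expabs.
apply: measurable_funB; apply: measurable_funM.
- by apply: measurableT_comp => //; exact: measurable_fst.
- apply: measurableT_comp mc.
  by apply: continuous_measurable_fun; exact: continuous_cos.
- by apply: measurableT_comp => //; exact: measurable_fst.
- apply: measurableT_comp mc.
  by apply: continuous_measurable_fun; exact: continuous_sin.
Qed.

Let trig_le (a b t : R) : `|a * cos t - b * sin t| <= `|a| + `|b|.
Proof.
apply: (le_trans (ler_normB _ _)); rewrite !normrM lerD//.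
  by rewrite ler_piMr// cos_max.
by rewrite ler_piMr// sin_max.
Qed.

Let integrable_pq : mu.-integrable [set: R] (EFin \o (fun x => `|p x| + `|q x|)).
Proof.
have := integrableD measurableT (integrable_norm ip) (integrable_norm iq).
by apply: eq_integrable.
Qed.

(** Tonelli: integrating the modulus over xi first leaves at most (2 / e) (|p(x)| + |q(x)|), which
    is integrable. *)
Let integrable_ker e y : 0 < e ->
  (mu \x mu)%E.-integrable [set: R * R] (EFin \o ker e y).
Proof.
move=> e0; apply/integrable12ltyP; first by apply/measurable_EFinP; exact: measurable_ker.
have /integrableP[_] := integrableZr measurableT (2 / e) integrable_pq.
apply: le_lt_trans; apply: ge0_le_integral => //=.
- by move=> x _; exact: integral_ge0.
- apply: (measurable_fun_fubini_tonelli_F (m2 := mu) (abse \o (EFin \o ker e y))) => //=.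
  by apply: measurableT_comp => //; apply/measurable_EFinP; exact: measurable_ker.
- apply/measurable_EFinP; apply: measurableT_comp => //; apply: measurable_funM => //.
  by apply: measurable_funD; exact: measurableT_comp.
- move=> x _; rewrite ger0_norm; last first.
    by rewrite mulr_ge0 ?addr_ge0// divr_ge0// ltW.
  rewrite EFinM -integral_expabs// -ge0_integralZl//; last 2 first.
  + apply/measurable_EFinP.
    by apply: continuous_measurable_fun; exact: continuous_expabs.
  + by move=> t _; rewrite lee_fin ltW// expabs_gt0.
  apply: ge0_le_integral => //=.
  + apply/measurable_EFinP; apply: measurableT_comp => //.
    apply: (measurableT_comp (measurable_ker e y)); exact: pair1_measurable.
  + apply/measurable_EFinP; apply: measurable_funM => //.
    by apply: continuous_measurable_fun; exact: continuous_expabs.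
  + move=> t _; rewrite -EFinM lee_fin /ker/= normrM (gtr0_norm (expabs_gt0 _ _)).
    by rewrite ler_wpM2r// ltW// expabs_gt0.
Qed.

Let integrable_trig_shift (y xi : R) : mu.-integrable [set: R]
  (EFin \o (fun x => p x * cos ((x - y) * xi) - q x * sin ((x - y) * xi))).
Proof.
apply: (le_integrable _ _ _ integrable_pq) => //.
- have mB : measurable_fun setT (fun x : R => (x - y) * xi).
    by apply: measurable_funM => //; exact: measurable_funB.
  apply/measurable_EFinP; apply: measurable_funB; apply: measurable_funM => //.
    apply: measurableT_comp mB.
    by apply: continuous_measurable_fun; exact: continuous_cos.
  apply: measurableT_comp mB.
  by apply: continuous_measurable_fun; exact: continuous_sin.
- by move=> x _; rewrite lee_fin [leRHS]ger0_norm ?addr_ge0.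
Qed.

Lemma integrable_trig (xi : R) : mu.-integrable [set: R]
  (EFin \o (fun x => p x * cos (x * xi) - q x * sin (x * xi))).
Proof.
by apply: eq_integrable (integrable_trig_shift 0 xi) => // x _ /=; rewrite subr0.
Qed.

(* The real part of the Fourier transform of p + iq; its imaginary part is
   cos_transform q (- p). *)
Definition cos_transform (xi : R) : R :=
  \int[mu]_x (p x * cos (x * xi) - q x * sin (x * xi)).

Lemma cos_transform_bounded (xi : R) :
  `|cos_transform xi| <= \int[mu]_x (`|p x| + `|q x|).
Proof.
apply: (le_trans (le_normr_Rintegral _ _)) => //.
  exact: integrable_trig.
by apply: le_Rintegral => //; exact: integrable_norm (integrable_trig xi).
Qed.

(** For e = 1 and y = 0 the section integrals of [ker] are measurable by Fubini, and they equal the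
    transform times the positive continuous factor [expabs 1], which can be divided out. *)
Lemma measurable_cos_transform : measurable_fun setT cos_transform.
Proof.
have /measurable_fubini_G := integrable_ker 0 ltr01.
rewrite /fubini_G => mG.
suff -> : cos_transform = fun xi =>
    fine (\int[mu]_x (ker 1 0 (x, xi))%:E)%E / expabs 1 xi.
  apply: measurable_funM; first exact: measurableT_comp.
  apply: continuous_measurable_fun => x; apply: cvgV; last exact: continuous_expabs.
  by rewrite gt_eqF// expabs_gt0.
apply/funext => xi; rewrite -[fine _]/(\int[mu]_x _).
under [in RHS]eq_Rintegral do rewrite /ker/= subr0.
by rewrite RintegralZr ?mulfK// ?gt_eqF ?expabs_gt0//; exact: integrable_trig.
Qed.

(** After exchanging the integrals, the inner one over xi turns the cosine into the Poisson kernel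
    and kills the sine, so only [p] survives. *)
Lemma cos_transform_poisson_fubini (e y : R) : 0 < e ->
  \int[mu]_xi ((\int[mu]_x
     (p x * cos ((x - y) * xi) - q x * sin ((x - y) * xi))) * expabs e xi) =
  \int[mu]_x (p x * poisson e (x - y)).
Proof.
move=> e0; have /Fubini/esym/(congr1 fine) := integrable_ker y e0.
congr (_ = _); apply: congr1; apply: eq_integral => t _ /=.
  rewrite -RintegralZr//; apply/esym/fineK; apply: integrable_fin_num => //.
  have := integrableZr measurableT (expabs e t) (integrable_trig_shift y t).
  by apply: eq_integrable.
transitivity (\int[mu]_xi (p t * (expabs e xi * cos ((t - y) * xi)) -
                           q t * (expabs e xi * sin ((t - y) * xi))))%:E%E.
  apply/esym; rewrite fineK.
    by apply: eq_integral => xi _ /=; rewrite /ker/=; congr EFin; ring.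
  apply: integrable_fin_num => //.
  have := integrableB measurableT
    (integrableZl measurableT (p t) (integrable_expabs_cos (t - y) e0))
    (integrableZl measurableT (q t) (integrable_expabs_sin (t - y) e0)).
  by apply: eq_integrable.
congr EFin; rewrite RintegralB//.
- rewrite !RintegralZl//; [|exact: integrable_expabs_sin|exact: integrable_expabs_cos].
  by rewrite Rintegral_expabs_cos// Rintegral_expabs_sin// mulr0 subr0.
- by have := integrableZl measurableT (p t) (integrable_expabs_cos (t - y) e0);
    apply: eq_integrable.
- by have := integrableZl measurableT (q t) (integrable_expabs_sin (t - y) e0);
    apply: eq_integrable.
Qed.

End FourierPoisson.

Section CosTransform.
Context {R : realType}.
Local Notation mu := (@lebesgue_measure R).

(** The bracket on the left is the real part of exp(- i y xi) times the transform of p + i q; the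
    subtraction formulas bring it to the shifted phase (x - y) xi. *)
Lemma cos_transform_poisson (p q : R -> R) (e y : R) : 0 < e ->
  mu.-integrable [set: R] (EFin \o p) -> mu.-integrable [set: R] (EFin \o q) ->
  \int[mu]_xi ((cos_transform p q xi * cos (y * xi) +
                cos_transform q (\- p) xi * sin (y * xi)) * expabs e xi) =
  \int[mu]_x (p x * poisson e (x - y)).
Proof.
move=> e0 ip iq; rewrite -(cos_transform_poisson_fubini ip iq)//.
have inp : mu.-integrable [set: R] (EFin \o (\- p)).
  exact: eq_integrable (integrableN ip).
apply: eq_Rintegral => xi _; congr (_ * _).
rewrite /cos_transform -!RintegralZr//; try exact: integrable_trig.
rewrite -RintegralD//; last 2 first.
- have := integrableZr measurableT (cos (y * xi)) (integrable_trig ip iq xi).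
  by apply: eq_integrable.
- have := integrableZr measurableT (sin (y * xi)) (integrable_trig iq inp xi).
  by apply: eq_integrable.
apply: eq_Rintegral => x _; rewrite (mulrBl xi x y) cosB sinB/=; ring.
Qed.

End CosTransform.

(** * Passage to L2 and removal of the damping *)

Section Inversion.
Context {R : realType}.
Local Notation mu := (@lebesgue_measure R).
Local Notation N2 f := (Lnorm mu 2%:E (EFin \o f)).

Lemma Lnorm2_expabsM (e : R) (f : R -> R) : 0 < e -> measurable_fun setT f ->
  (forall x, `|f x| <= 1) -> (N2 (fun x => f x * expabs e x)%R < +oo)%E.
Proof.
move=> e0 mf f1; apply: (@bounded_integrable_Lnorm2 _ _ 1) => [|x].
  apply: eq_integrable (integrable_expabsM e0 mf f1) => // x _ /=.
  by rewrite mulrC.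
rewrite normrM mulr_ile1// gtr0_norm ?expabs_gt0//.
exact/expabs_le1/ltW.
Qed.

Lemma Lnorm2_poisson (e y : R) : 0 < e ->
  (N2 (fun x => poisson e (x - y))%R < +oo)%E.
Proof.
move=> e0; apply: (@bounded_integrable_Lnorm2 _ _ (2 / e)) => [|x].
  exact: integrable_poisson.
by rewrite gtr0_norm ?poisson_gt0// poisson_le.
Qed.

Lemma measurable_poissonB (e y : R) : 0 < e ->
  measurable_fun setT (fun x : R => poisson e (x - y)).
Proof.
move=> e0; apply/measurable_EFinP.
exact: measurable_int (integrable_poisson y e0).
Qed.

Lemma integrable_expabs_bounded (e C : R) (v w : R -> R) : 0 < e ->
  measurable_fun setT v -> (forall x, `|v x| <= C) ->
  measurable_fun setT w -> (forall x, `|w x| <= 1) ->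
  mu.-integrable setT (EFin \o (fun x => v x * (w x * expabs e x))).
Proof.
move=> e0 mv vC mw w1.
have me : measurable_fun setT (expabs e).
  by apply: continuous_measurable_fun; exact: continuous_expabs.
have := integrableZl measurableT C (integrable_expabs e0).
apply: le_integrable => //.
  by apply/measurable_EFinP; apply: measurable_funM => //; exact: measurable_funM.
move=> x _ /=; rewrite lee_fin !normrM mulrA ler_wpM2r//.
by rewrite -[leRHS]mulr1 ler_pM// (le_trans (vC x))// ler_norm.
Qed.

(** The identity holds for each pair [p k], [q k] of integrable functions. Both sides are pairings
    with fixed L2 functions, so they pass to the L2 limit, and limits are unique. *)
Lemma weighted_inversion (p q : nat -> R -> R) (f g1 g2 : R -> R) (e y : R) :
  0 < e ->
  (forall k, mu.-integrable [set: R] (EFin \o p k)) ->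
  (forall k, mu.-integrable [set: R] (EFin \o q k)) ->
  measurable_fun setT f -> (N2 f < +oo)%E ->
  measurable_fun setT g1 -> (N2 g1 < +oo)%E ->
  measurable_fun setT g2 -> (N2 g2 < +oo)%E ->
  N2 (fun x => p k x - f x) @[k --> \oo] --> 0%E ->
  N2 (fun x => cos_transform (p k) (q k) x - g1 x) @[k --> \oo] --> 0%E ->
  N2 (fun x => cos_transform (q k) (\- p k) x - g2 x) @[k --> \oo] --> 0%E ->
  \int[mu]_xi ((g1 xi * cos (y * xi) + g2 xi * sin (y * xi)) * expabs e xi) =
  \int[mu]_x (f x * poisson e (x - y)).
Proof.
move=> e0 ip iq mf Nf mg1 Ng1 mg2 Ng2 pf Ag1 Bg2.
have inp k : mu.-integrable [set: R] (EFin \o (\- p k)).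
  exact: eq_integrable (integrableN (ip k)).
have mp k : measurable_fun setT (p k).
  by apply/measurable_EFinP; exact: measurable_int (ip k).
have mc : measurable_fun setT (fun x : R => cos (y * x)).
  by apply: continuous_measurable_fun; exact: continuous_cosM.
have ms : measurable_fun setT (fun x : R => sin (y * x)).
  by apply: continuous_measurable_fun; exact: continuous_sinM.
have me : measurable_fun setT (expabs e).
  by apply: continuous_measurable_fun; exact: continuous_expabs.
have mce : measurable_fun setT (fun x : R => cos (y * x) * expabs e x).
  exact: measurable_funM.
have mse : measurable_fun setT (fun x : R => sin (y * x) * expabs e x).
  exact: measurable_funM.
have Nc := Lnorm2_expabsM e0 mc (fun x => cos_max (y * x)).
have Ns := Lnorm2_expabsM e0 ms (fun x => sin_max (y * x)).
have mA k := measurable_cos_transform (ip k) (iq k).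
have mB k := measurable_cos_transform (iq k) (inp k).
have iA k : mu.-integrable setT
    (EFin \o (fun x => cos_transform (p k) (q k) x * (cos (y * x) * expabs e x))).
  apply: integrable_expabs_bounded e0 (mA k) _ mc _ => x; last exact: cos_max.
  exact: cos_transform_bounded.
have iB k : mu.-integrable setT
    (EFin \o (fun x => cos_transform (q k) (\- p k) x * (sin (y * x) * expabs e x))).
  apply: integrable_expabs_bounded e0 (mB k) _ ms _ => x; last exact: sin_max.
  exact: cos_transform_bounded.
have i1 := integrable_mulL2 mg1 mce Ng1 Nc.
have i2 := integrable_mulL2 mg2 mse Ng2 Ns.
have c1 := cvg_Rintegral_mulL2 mA mg1 mce Nc iA i1 Ag1.
have c2 := cvg_Rintegral_mulL2 mB mg2 mse Ns iB i2 Bg2.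
have mP := measurable_poissonB y e0.
have NP := Lnorm2_poisson y e0.
have ipP k : mu.-integrable setT (EFin \o (fun x => p k x * poisson e (x - y))).
  have := integrableZr measurableT (2 / e) (ip k).
  apply: le_integrable => //.
    by apply/measurable_EFinP; exact: measurable_funM (mp k) mP.
  move=> x _ /=; rewrite lee_fin normrM [leRHS]normrM ler_wpM2l//.
  rewrite (gtr0_norm (poisson_gt0 _ e0)) (le_trans (poisson_le _ e0))//.
  exact: ler_norm.
have c3 := cvg_Rintegral_mulL2 mp mf mP NP ipP (integrable_mulL2 mf mP Nf NP) pf.
apply: (@cvg_unique _ (@Rhausdorff R)) c3.
have -> : \int[mu]_xi ((g1 xi * cos (y * xi) + g2 xi * sin (y * xi)) * expabs e xi) =
    \int[mu]_x (g1 x * (cos (y * x) * expabs e x)) +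
    \int[mu]_x (g2 x * (sin (y * x) * expabs e x)).
  by rewrite -RintegralD//; apply: eq_Rintegral => x _; ring.
rewrite (_ : (fun k => _) = fun k =>
    \int[mu]_x (cos_transform (p k) (q k) x * (cos (y * x) * expabs e x)) +
    \int[mu]_x (cos_transform (q k) (\- p k) x * (sin (y * x) * expabs e x))).
  exact: cvgD c1 c2.
apply/funext => k; rewrite -(cos_transform_poisson y e0 (ip k) (iq k)).
by rewrite -RintegralD//; apply: eq_Rintegral => x _; ring.
Qed.

(* Away from y the kernel P_e is at most a constant times e P_1; this replaces
   a splitting of the domain of integration. *)
Lemma poisson_away (e d t : R) : 0 < e -> 0 < d -> d <= `|t| ->
  poisson e t <= e * ((1 + (d ^+ 2)^-1) * poisson 1 t).
Proof.
move=> e0 d0 dt.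
have t20 : d ^+ 2 <= t ^+ 2.
  by rewrite -[leRHS]real_normK ?num_real// lerXn2r ?nnegrE// ltW.
have d20 : 0 < d ^+ 2 by rewrite exprn_gt0.
have t2 : 0 < t ^+ 2 by exact: lt_le_trans t20.
have e2 : 0 < e ^+ 2 by rewrite exprn_gt0.
apply: (@le_trans _ _ (2 * e / t ^+ 2)).
  rewrite /poisson ler_pM2l ?mulr_gt0// lef_pV2 ?posrE ?addr_gt0//.
  by rewrite lerDr ltW.
rewrite /poisson mulr1 expr1n.
have -> : e * ((1 + (d ^+ 2)^-1) * (2 / (1 + t ^+ 2))) =
  (2 * e) * ((1 + (d ^+ 2)^-1) / (1 + t ^+ 2)) by ring.
rewrite ler_pM2l ?mulr_gt0//.
rewrite ler_pdivlMr ?addr_gt0// mulrDr mulVf ?gt_eqF// mulr1 addrC lerD2l.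
by rewrite lef_pV2 ?posrE.
Qed.

(** An approximate identity argument. The kernel has mass 2 pi, so the difference is the integral of
    (f(x) - f(y)) P_e(x - y). Continuity controls it near y, [poisson_away] elsewhere. *)
Lemma poisson_approx (f : R -> R) (y eta : R) :
  measurable_fun setT f -> (N2 f < +oo)%E -> {for y, continuous f} -> 0 < eta ->
  exists2 e0 : R, 0 < e0 & forall e, 0 < e < e0 ->
    `|\int[mu]_x (f x * poisson e (x - y)) - 2 * pi * f y| <= eta.
Proof.
move=> mf Nf cf eta0.
have ifP e : 0 < e -> mu.-integrable setT (EFin \o (fun x => f x * poisson e (x - y))).
  move=> e0; apply: integrable_mulL2 => //; first exact: measurable_poissonB.
  exact: Lnorm2_poisson.
have icP e : 0 < e -> mu.-integrable setT (EFin \o (fun x => f y * poisson e (x - y))).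
  move=> e0; have := integrableZl measurableT (f y) (integrable_poisson y e0).
  exact: eq_integrable.
have idP e : 0 < e ->
    mu.-integrable setT (EFin \o (fun x => (f x - f y) * poisson e (x - y))).
  move=> e0; have := integrableB measurableT (ifP e e0) (icP e e0).
  by apply: eq_integrable => // x _ /=; rewrite mulrBl.
have iaP e : 0 < e ->
    mu.-integrable setT (EFin \o (fun x => `|f x - f y| * poisson e (x - y))).
  move=> e0; apply: eq_integrable (integrable_norm (idP e e0)) => // x _ /=.
  by rewrite normrM (gtr0_norm (poisson_gt0 _ e0)).
pose K := \int[mu]_x (`|f x - f y| * poisson 1 (x - y)).
have K0 : 0 <= K.
  by apply: Rintegral_ge0 => x _; rewrite mulr_ge0// ltW// poisson_gt0.
(* Against the mass 2 pi the near part contributes eta / 2. *)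
pose h := eta / (4 * pi).
have pi0 : 0 < pi :> R by exact: pi_gt0.
have h0 : 0 < h by rewrite divr_gt0// mulr_gt0.
have [d /= d0 dP] := (cvgrPdist_le _ _).1 cf h h0.
pose D := 1 + (d ^+ 2)^-1.
have D0 : 0 < D by rewrite addr_gt0// invr_gt0 exprn_gt0.
(* Below this value of [e] the far part e D K is at most eta / 2; the + 1 covers K = 0. *)
exists (eta / (2 * (D * (K + 1)))).
  by rewrite divr_gt0// !mulr_gt0// ltr_wpDl.
move=> e /andP[e0 ee].
have -> : \int[mu]_x (f x * poisson e (x - y)) - 2 * pi * f y =
    \int[mu]_x ((f x - f y) * poisson e (x - y)).
  rewrite -(Rintegral_poisson y e0) mulrC -RintegralZl//; last exact: integrable_poisson.
  rewrite -RintegralB//; [|exact: ifP|exact: icP].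
  by apply: eq_Rintegral => x _; rewrite mulrBl.
apply: (le_trans (le_normr_Rintegral measurableT (idP e e0))).
(* The sum of the near and far bounds dominates the integrand at every x, whichever of the two
   applies there. *)
apply: (@le_trans _ _ (\int[mu]_x (h * poisson e (x - y) +
    e * D * (`|f x - f y| * poisson 1 (x - y))))).
  apply: le_Rintegral => //.
  - exact: integrable_norm (idP e e0).
  - have := integrableD measurableT
      (integrableZl measurableT h (integrable_poisson y e0))
      (integrableZl measurableT (e * D) (iaP 1 ltr01)).
    exact: eq_integrable.
  - move=> x _; rewrite normrM (gtr0_norm (poisson_gt0 _ e0)).
    have [xd|xd] := ltP `|x - y| d.
      rewrite -[leLHS]addr0 lerD//.
        rewrite ler_wpM2r// ?(ltW (poisson_gt0 _ e0))// distrC; apply: dP.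
        by rewrite /ball_/= distrC.
      apply: mulr_ge0; first by rewrite mulr_ge0 ?ltW.
      by rewrite mulr_ge0// ltW// poisson_gt0.
    rewrite -[leLHS]add0r lerD//.
      by apply: mulr_ge0; rewrite ltW// poisson_gt0.
    by rewrite [leRHS]mulrCA ler_wpM2l// -mulrA; exact: poisson_away.
rewrite RintegralD//; last 2 first.
- have := integrableZl measurableT h (integrable_poisson y e0).
  exact: eq_integrable.
- have := integrableZl measurableT (e * D) (iaP 1 ltr01).
  exact: eq_integrable.
rewrite (RintegralZl _ measurableT (integrable_poisson y e0)).
rewrite (RintegralZl _ measurableT (iaP 1 ltr01)).
rewrite Rintegral_poisson// -/K.
have hE (c : R) : 0 < c -> eta / (4 * c) * (2 * c) = eta / 2.
  by move=> c0; field; rewrite gt_eqF.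
rewrite {1}/h hE//.
have : e * D * K <= eta / 2.
  move: ee; rewrite ltr_pdivlMr ?mulr_gt0// ?ltr_wpDl// => ee.
  have : 0 <= e * D by rewrite mulr_ge0// ltW.
  nra.
lra.
Qed.

(** On [- L, L], outside of which [g] vanishes, 0 <= 1 - exp(- e |x|) <= e |x| <= e L. *)
Lemma expabs_approx (g : R -> R) (L e : R) :
  mu.-integrable setT (EFin \o g) -> (forall x, L < `|x| -> g x = 0) -> 0 < e ->
  `|\int[mu]_x (g x * expabs e x) - \int[mu]_x g x| <=
    e * (L * \int[mu]_x `|g x|).
Proof.
move=> ig gL e0.
have mg : measurable_fun setT g by apply/measurable_EFinP; exact: measurable_int ig.
have me : measurable_fun setT (expabs e).
  by apply: continuous_measurable_fun; exact: continuous_expabs.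
have ige : mu.-integrable setT (EFin \o (fun x => g x * expabs e x)).
  apply: (le_integrable _ _ _ ig) => //.
    by apply/measurable_EFinP; exact: measurable_funM.
  move=> x _; rewrite lee_fin normrM ler_piMr// gtr0_norm ?expabs_gt0//.
  exact/expabs_le1/ltW.
rewrite -RintegralB//.
have iB : mu.-integrable setT (EFin \o (fun x => g x * expabs e x - g x)).
  exact: eq_integrable (integrableB measurableT ige ig).
apply: (le_trans (le_normr_Rintegral measurableT iB)).
have ia := integrable_norm ig.
rewrite mulrA -RintegralZl//; apply: le_Rintegral => //.
- exact: integrable_norm.
- have := integrableZl measurableT (e * L) ia.
  exact: eq_integrable.
- move=> x _ /=; have [xL|xL] := ltP L `|x|.
    by rewrite (gL _ xL) mul0r subrr normr0 mulr0.
  rewrite -{2}[g x]mulr1 -mulrBr normrM mulrC ler_wpM2r//.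
  rewrite distrC ger0_norm; last by rewrite subr_ge0 expabs_le1// ltW.
  apply: (@le_trans _ _ (e * `|x|)); last by rewrite ler_pM2l.
  by rewrite lerBlDr -lerBlDl /expabs expR_ge1Dx.
Qed.

(** In the weighted identity [e] is taken so small that removing the damping and replacing the
    Poisson integral by 2 pi f(y) each cost at most eta / 2. *)
Lemma L2_inversion (p q : nat -> R -> R) (f g1 g2 : R -> R) (L y : R) :
  (forall k, mu.-integrable [set: R] (EFin \o p k)) ->
  (forall k, mu.-integrable [set: R] (EFin \o q k)) ->
  measurable_fun setT f -> (N2 f < +oo)%E -> {for y, continuous f} ->
  measurable_fun setT g1 -> (N2 g1 < +oo)%E ->
  measurable_fun setT g2 -> (N2 g2 < +oo)%E ->
  mu.-integrable setT (EFin \o (fun xi => g1 xi * cos (y * xi) + g2 xi * sin (y * xi))) ->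
  (forall x, L < `|x| -> g1 x = 0) -> (forall x, L < `|x| -> g2 x = 0) ->
  N2 (fun x => p k x - f x) @[k --> \oo] --> 0%E ->
  N2 (fun x => cos_transform (p k) (q k) x - g1 x) @[k --> \oo] --> 0%E ->
  N2 (fun x => cos_transform (q k) (\- p k) x - g2 x) @[k --> \oo] --> 0%E ->
  2 * pi * f y = \int[mu]_xi (g1 xi * cos (y * xi) + g2 xi * sin (y * xi)).
Proof.
move=> ip iq mf Nf cf mg1 Ng1 mg2 Ng2 iG g1L g2L pf Ag1 Bg2.
apply/eqP; rewrite -subr_eq0 -normr_le0; apply/ler_addgt0Pr => eta eta0.
rewrite add0r.
have [e1 e10 He1] := poisson_approx mf Nf cf (divr_gt0 eta0 (ltr0Sn _ 1)).
pose G xi := g1 xi * cos (y * xi) + g2 xi * sin (y * xi).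
have GL x : L < `|x| -> G x = 0 by move=> Lx; rewrite /G g1L// g2L// !mul0r addr0.
(* The absolute value and the + 1 make [K] positive whatever the sign of [L]. *)
pose K := `|L * \int[mu]_x `|G x| | + 1.
have K0 : 0 < K by rewrite ltr_wpDl.
pose e := Num.min (e1 / 2) (eta / 2 / K).
have e0 : 0 < e by rewrite lt_min !divr_gt0.
have ee1 : e < e1 by rewrite gt_min ltr_pdivrMr// ltr_pMr// ltr1n.
have := expabs_approx iG GL e0.
rewrite (weighted_inversion y e0 ip iq mf Nf mg1 Ng1 mg2 Ng2 pf Ag1 Bg2).
have := He1 e; rewrite e0 ee1 => /(_ isT).
have : e * (L * \int[mu]_x `|G x|) <= eta / 2.
  apply: (@le_trans _ _ (e * K)).
    by rewrite ler_pM2l// /K (le_trans (ler_norm _))// lerDl.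
  by rewrite -ler_pdivlMr// ge_min lexx orbT.
rewrite -/(G _) => H1 H2 H3.
have H4 := le_trans H3 H1.
have := ler_distD (\int[mu]_x (f x * poisson e (x - y))) (2 * pi * f y) (\int[mu]_x G x).
move=> /le_trans; apply.
by rewrite [leRHS]splitr lerD// distrC.
Qed.

End Inversion.

(** * Inversion for complex-valued functions *)

Section ComplexInversion.
Context {R : realType}.
Local Notation mu := (@lebesgue_measure R).
Local Notation N2 f := (Lnorm mu 2%:E (EFin \o f)).

Lemma in_LpP (p : \bar R) (f : R -> R[i]) : in_Lp p f ->
  [/\ measurable_fun setT (Rpart f), measurable_fun setT (Ipart f),
      (Lnorm mu p (EFin \o Rpart f) < +oo)%E &
      (Lnorm mu p (EFin \o Ipart f) < +oo)%E].
Proof.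
rewrite /in_Lp !inE => -[/andP[]]; rewrite !inE/= => mr nr /andP[]; rewrite !inE/=.
by move=> mi ni; split.
Qed.

Lemma in_L1_integrable (f : R -> R[i]) : in_Lp 1%:E f ->
  mu.-integrable setT (EFin \o Rpart f) /\ mu.-integrable setT (EFin \o Ipart f).
Proof.
move=> /in_LpP[mr mi]; rewrite !Lnorm1 => nr ni.
by split; apply/integrableP; split => //; exact/measurable_EFinP.
Qed.

Lemma le_Lnorm2 (a b : R -> R) : measurable_fun setT a -> measurable_fun setT b ->
  (forall x, `|a x| <= `|b x|) -> (N2 a <= N2 b)%E.
Proof.
move=> ma mb ab; rewrite unlock; apply: gt0_ler_poweR.
- by rewrite invr_ge0.
- by rewrite in_itv/= leey andbT integral_ge0// => x _; exact: poweR_ge0.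
- by rewrite in_itv/= leey andbT integral_ge0// => x _; exact: poweR_ge0.
have mp (c : R -> R) : measurable_fun setT c ->
    measurable_fun setT (fun x => (`|(c x)%:E| `^ 2)%E).
  move=> mc; apply/measurable_EFinP.
  apply: (@measurableT_comp _ _ _ _ _ _ (fun x => x `^ 2)) => //.
  exact: measurableT_comp.
apply: ge0_le_integral => //; [|exact: mp|exact: mp|].
- by move=> x _; exact: poweR_ge0.
- by move=> x _; rewrite lee_fin ge0_ler_powR// nnegrE.
Qed.

Lemma le_Re_normc (z : R[i]) : `|complex.Re z| <= cmod z.
Proof.
case: z => a b /=; rewrite -[leLHS]sqrtr_sqr ler_wsqrtr//.
by rewrite lerDl sqr_ge0.
Qed.

Lemma le_Im_normc (z : R[i]) : `|complex.Im z| <= cmod z.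
Proof.
case: z => a b /=; rewrite -[leLHS]sqrtr_sqr ler_wsqrtr//.
by rewrite lerDr sqr_ge0.
Qed.

Lemma ReB (z w : R[i]) : complex.Re (z - w) = complex.Re z - complex.Re w.
Proof. by case: z w => [a b] [c d]. Qed.

Lemma ImB (z w : R[i]) : complex.Im (z - w) = complex.Im z - complex.Im w.
Proof. by case: z w => [a b] [c d]. Qed.

Lemma cvg_L2dist_parts (u : nat -> R -> R[i]) (f : R -> R[i]) :
  (forall k, measurable_fun setT (Rpart (u k))) ->
  (forall k, measurable_fun setT (Ipart (u k))) ->
  measurable_fun setT (Rpart f) -> measurable_fun setT (Ipart f) ->
  L2dist (u k) f @[k --> \oo] --> 0%E ->
  N2 (fun x => complex.Re (u k x) - complex.Re (f x)) @[k --> \oo] --> 0%E /\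
  N2 (fun x => complex.Im (u k x) - complex.Im (f x)) @[k --> \oo] --> 0%E.
Proof.
move=> mur mui mfr mfi uf.
have mrB k : measurable_fun setT (fun x => complex.Re (u k x) - complex.Re (f x)).
  exact: measurable_funB.
have miB k : measurable_fun setT (fun x => complex.Im (u k x) - complex.Im (f x)).
  exact: measurable_funB.
have mn k : measurable_fun setT (fun x => cmod (u k x - f x)).
  rewrite (_ : (fun x => _) = fun x => Num.sqrt
      ((complex.Re (u k x) - complex.Re (f x)) ^+ 2 +
       (complex.Im (u k x) - complex.Im (f x)) ^+ 2)).
    apply: (@measurableT_comp _ _ _ _ _ _ (@Num.sqrt R)).
      by apply: continuous_measurable_fun; exact: sqrt_continuous.
    by apply: measurable_funD; exact: measurable_funX.
  by apply/funext => x; case: (u k x) (f x) => [a b] [c d].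
split; apply: (@squeeze_cvge _ _ _ _ (cst 0%E) _ (fun k => L2dist (u k) f)) => //;
  try exact: cvg_cst; apply: nearW => k; rewrite Lnorm_ge0/=; apply: le_Lnorm2 => // x;
  rewrite [leRHS]ger0_norm ?sqrtr_ge0.
- by rewrite -ReB le_Re_normc.
- by case: (u k x - f x) => a b; exact: sqrtr_ge0.
- by rewrite -ImB le_Im_normc.
- by case: (u k x - f x) => a b; exact: sqrtr_ge0.
Qed.

Lemma Re_fourier (f : R -> R[i]) (xi : R) :
  complex.Re (fourier f xi) = cos_transform (Rpart f) (Ipart f) xi.
Proof. by apply: eq_Rintegral => x _; case: (f x). Qed.

Lemma Im_fourier (f : R -> R[i]) (xi : R) :
  complex.Im (fourier f xi) = cos_transform (Ipart f) (\- Rpart f) xi.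
Proof.
apply: eq_Rintegral => x _; rewrite /=; case: (f x) => a b /=.
by rewrite mulNr opprK addrC.
Qed.

(** The real and imaginary parts of 2 pi f(y) = int g(xi) exp(- i y xi) dxi. *)
Lemma fourier_L2_inversion (f g : R -> R[i]) (L y : R) :
  is_fourier_L2 f g ->
  {for y, continuous (Rpart f)} -> {for y, continuous (Ipart f)} ->
  mu.-integrable setT (EFin \o Rpart g) -> mu.-integrable setT (EFin \o Ipart g) ->
  (forall x, L < `|x| -> complex.Re (g x) = 0) ->
  (forall x, L < `|x| -> complex.Im (g x) = 0) ->
  2 * pi * complex.Re (f y) = \int[mu]_xi
    (complex.Re (g xi) * cos (y * xi) + complex.Im (g xi) * sin (y * xi)) /\
  2 * pi * complex.Im (f y) = \int[mu]_xi
    (complex.Im (g xi) * cos (y * xi) - complex.Re (g xi) * sin (y * xi)).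
Proof.
move=> [/in_LpP[mfr mfi Nfr Nfi] /in_LpP[mgr mgi Ngr Ngi] [u [u1 u2 uf ug]]].
move=> cr ci ir ii gLr gLi.
have mur k := let: And4 a _ _ _ := in_LpP (u2 k) in a.
have mui k := let: And4 _ a _ _ := in_LpP (u2 k) in a.
have iur k := (in_L1_integrable (u1 k)).1.
have iui k := (in_L1_integrable (u1 k)).2.
have neg (h : R -> R) : mu.-integrable setT (EFin \o h) ->
    mu.-integrable setT (EFin \o (\- h)).
  by move=> ih; exact: eq_integrable (integrableN ih).
have iuN k := neg _ (iur k).
have [ufr ufi] := cvg_L2dist_parts mur mui mfr mfi uf.
have eR k : Rpart (fourier (u k)) = cos_transform (Rpart (u k)) (Ipart (u k)).
  by apply/funext => xi; exact: Re_fourier.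
have eI k : Ipart (fourier (u k)) = cos_transform (Ipart (u k)) (\- Rpart (u k)).
  by apply/funext => xi; exact: Im_fourier.
have mFr k : measurable_fun setT (Rpart (fourier (u k))).
  by rewrite eR; exact: measurable_cos_transform.
have mFi k : measurable_fun setT (Ipart (fourier (u k))).
  by rewrite eI; exact: measurable_cos_transform.
have [ugr ugi] := cvg_L2dist_parts mFr mFi mgr mgi ug.
have mc : measurable_fun setT (fun x : R => cos (y * x)).
  by apply: continuous_measurable_fun; exact: continuous_cosM.
have ms : measurable_fun setT (fun x : R => sin (y * x)).
  by apply: continuous_measurable_fun; exact: continuous_sinM.
have iM (h w : R -> R) : mu.-integrable setT (EFin \o h) -> measurable_fun setT w ->
    (forall x, `|w x| <= 1) -> mu.-integrable setT (EFin \o (fun x => h x * w x)).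
  move=> ih mw w1; have mh : measurable_fun setT h.
    by apply/measurable_EFinP; exact: measurable_int ih.
  apply: (le_integrable _ _ _ ih) => //.
    by apply/measurable_EFinP; exact: measurable_funM.
  by move=> x _; rewrite lee_fin normrM ler_piMr.
have iD (h k : R -> R) : mu.-integrable setT (EFin \o h) ->
    mu.-integrable setT (EFin \o k) ->
    mu.-integrable setT (EFin \o (fun x => h x * cos (y * x) + k x * sin (y * x))).
  move=> ih ik.
  have ihc := iM _ _ ih mc (fun x => cos_max _).
  have iks := iM _ _ ik ms (fun x => sin_max _).
  exact: eq_integrable (integrableD measurableT ihc iks).
split.
  apply: (L2_inversion iur iui mfr Nfr cr mgr Ngr mgi Ngi (iD _ _ ir ii) gLr gLi ufr).
    by under eq_fun do under eq_fun do rewrite -Re_fourier.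
  by under eq_fun do under eq_fun do rewrite -Im_fourier.
(* The imaginary part is the real part of - i f, whose transform is - i g: the pair (Re, Im) becomes
   (Im, - Re). *)
have := @L2_inversion _ (fun k => Ipart (u k)) (fun k => \- Rpart (u k)) (Ipart f)
  (Ipart g) (\- Rpart g) L y iui iuN mfi Nfi ci mgi Ngi.
move=> -> //.
- by apply: eq_Rintegral => x _; rewrite mulNr.
- exact: measurableT_comp.
- by rewrite (_ : EFin \o _ = \- (EFin \o Rpart g))%E ?oppe_Lnorm//; apply/funext.
- exact: (iD _ _ ii (neg _ ir)).
- by move=> x Lx /=; rewrite gLr// oppr0.
- by under eq_fun do under eq_fun do rewrite -Im_fourier.
(* The remaining convergence is that of the real parts with both signs reversed, which leaves the
   norm unchanged. *)
rewrite (_ : (fun k => _) = fun k =>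
    N2 (fun x => complex.Re (fourier (u k) x) - complex.Re (g x)))//.
apply/funext => k; rewrite -oppe_Lnorm; apply: eq_Lnorm => x /=.
have /= -> := Re_fourier (u k) x; rewrite opprD opprK; congr (_ - _)%:E.
rewrite /cos_transform -mulN1r -RintegralZl//.
  by apply: eq_Rintegral => z _ /=; ring.
exact: (integrable_trig (iuN k) (neg _ (iui k))).
Qed.

End ComplexInversion.

(** * Trigonometric integrals of functions with bounded derivatives *)

Section DerivativeBounds.
Context {R : realType}.
Implicit Types (A : nat -> R) (F G : R -> R) (c L x : R).

(** The constant [c] is kept apart from the sequence [A]: differentiation shifts [A] and keeps [c],
    multiplication by the variable changes [c] and keeps [A]. *)
Definition bounded_derivs L A c F : Prop :=
  [/\ forall n x, derivable (derive1n n F) x 1,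
      forall x, L < `|x| -> F x = 0 &
      forall n x, `|derive1n n F x| <= c * A n].

Lemma derive1_vanish L F : (forall x, L < `|x| -> F x = 0) ->
  forall x, L < `|x| -> derive1 F x = 0.
Proof.
move=> FL x Lx; rewrite derive1E (@near_eq_derive _ _ _ F (cst 0)).
  exact: derive_cst.
have : \forall z \near x, L < `|z|.
  have /(cvgr_gt _)/(_ _ Lx) : `|z| @[z --> x] --> `|x| by exact: norm_continuous.
  exact.
by apply: filterS => z; exact: FL.
Qed.

Lemma derive1n_vanish L F n : (forall x, L < `|x| -> F x = 0) ->
  forall x, L < `|x| -> derive1n n F x = 0.
Proof.
by move=> FL; elim: n => [|n IH] //; rewrite derive1nS; exact: derive1_vanish.
Qed.

Lemma bounded_derivs_ge0 L A c F n : bounded_derivs L A c F -> 0 <= c * A n.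
Proof. by move=> [_ _ /(_ n 0)]; exact: le_trans. Qed.

Lemma bounded_derivs_derive1 L A c F : bounded_derivs L A c F ->
  bounded_derivs L (fun n => A n.+1) c (derive1 F).
Proof.
move=> [dF FL FA]; split => [n x|x|n x].
- by rewrite -derive1Sn.
- exact: derive1_vanish.
- by rewrite -derive1Sn.
Qed.

Lemma derive1nN F n : (forall n x, derivable (derive1n n F) x 1) ->
  derive1n n (\- F) = \- derive1n n F.
Proof.
move=> dF; elim: n => [//|n IH]; rewrite derive1nS IH; apply/funext => x.
by rewrite derive1N// derive1nS.
Qed.

Lemma bounded_derivsN L A c F : bounded_derivs L A c F ->
  bounded_derivs L A c (\- F).
Proof.
move=> [dF FL FA]; split => [n x|x Lx|n x].
- by rewrite derive1nN//; exact: derivableN.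
- by rewrite /= FL// oppr0.
- by rewrite derive1nN//= normrN.
Qed.

Lemma derive1_mulidD (u v : R -> R) (m x : R) : derivable u x 1 -> derivable v x 1 ->
  derivable (fun y : R => y * u y + m * v y) x 1 /\
  derive1 (fun y : R => y * u y + m * v y) x = u x + x * derive1 u x + m * derive1 v x.
Proof.
move=> du dv.
have duE : is_derive x 1 u (derive1 u x) by rewrite derive1E; exact/derivableP.
have dvE : is_derive x 1 v (derive1 v x) by rewrite derive1E; exact/derivableP.
have D : is_derive x 1 (fun y : R => y * u y + m * v y)
    (u x + x * derive1 u x + m * derive1 v x).
  by apply: is_derive_eq; rewrite /GRing.scale/=; ring.
by split; [exact: ex_derive|rewrite derive1E derive_val].
Qed.

(** Leibniz' rule, where the derivatives of x beyond the first vanish. For n = 0 the coefficient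
    n%:R cancels the spurious term in [n.-1]. *)
Lemma derive1n_mulid F n : (forall n x, derivable (derive1n n F) x 1) ->
  derive1n n (fun x => x * F x) =
  (fun x => x * derive1n n F x + n%:R * derive1n n.-1 F x).
Proof.
move=> dF; elim: n => [|n IH]; first by apply/funext => x; rewrite mul0r addr0.
rewrite derive1nS IH; apply/funext => x.
rewrite (derive1_mulidD n%:R (dF n x) (dF n.-1 x)).2 -!derive1nS addrAC addrC.
congr (_ + _); case: n {IH} => [|n]; first by rewrite mul0r addr0 mul1r.
by rewrite -[in RHS]natr1 mulrDl mul1r addrC.
Qed.

(** In Leibniz' rule the first term is at most L c A_n on [- L, L], the second at most c n A_(n-1)
    <= c A_n; outside, both vanish. *)
Lemma bounded_derivs_mulid L A c F : 0 <= L ->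
  (forall n, n.+1%:R * A n <= A n.+1) -> 0 <= c ->
  bounded_derivs L A c F -> bounded_derivs L A (c * (L + 1)) (fun x => x * F x).
Proof.
move=> L0 AA c0 bF; have [dF FL FA] := bF; split => [n x|x Lx|n x].
- rewrite derive1n_mulid//.
  by have [] := derive1_mulidD n%:R (dF n x) (dF n.-1 x).
- by rewrite FL// mulr0.
rewrite derive1n_mulid//.
have [Lx|xL] := ltP L `|x|.
  rewrite !(derive1n_vanish _ FL)// !mulr0 addr0 normr0 mulrAC.
  by rewrite mulr_ge0 ?(bounded_derivs_ge0 n bF)// addr_ge0.
rewrite (le_trans (ler_normD _ _))// !normrM.
have -> : c * (L + 1) * A n = L * (c * A n) + c * A n by ring.
rewrite lerD//; first by rewrite ler_pM.
case: n => [|n]; first by rewrite normr0 mul0r (bounded_derivs_ge0 _ bF).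
rewrite ger0_norm//= (le_trans _ (ler_wpM2l c0 (AA n)))//.
by rewrite mulrCA ler_wpM2l.
Qed.

End DerivativeBounds.

(** * Differentiation and decay of trigonometric integrals *)

Section TrigIntegral.
Context {R : realType}.
Local Notation mu := (@lebesgue_measure R).
Implicit Types (F G : R -> R) (T x : R).

(** The real part of int (F + i G)(xi) exp(- i x xi) dxi over [- T, T]. Differentiating it in x, or
    multiplying it by x, only changes the pair (F, G). *)
Definition trig_integral T F G x : R :=
  \int[mu]_(xi in `[- T, T]) (F xi * cos (x * xi) + G xi * sin (x * xi)).

Lemma continuous_trig F G x : continuous F -> continuous G ->
  continuous (fun xi => F xi * cos (x * xi) + G xi * sin (x * xi)).
Proof.
move=> cF cG xi; apply: cvgD; apply: cvgM.
- exact: cF.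
- exact: continuous_cosM.
- exact: cG.
- exact: continuous_sinM.
Qed.

Lemma continuous_itv_integrable T F : continuous F ->
  mu.-integrable `[- T, T] (EFin \o F).
Proof.
move=> cF; apply: continuous_compact_integrable; first exact: segment_compact.
exact: continuous_subspaceT.
Qed.

Lemma norm_trig_integral_le T F G C x : 0 < T -> continuous F -> continuous G ->
  (forall xi, `|F xi| <= C) -> (forall xi, `|G xi| <= C) ->
  `|trig_integral T F G x| <= 4 * T * C.
Proof.
move=> T0 cF cG FC GC.
have ci := @continuous_trig F G x cF cG.
apply: (le_trans (le_normr_Rintegral _ _)) => //; first exact: continuous_itv_integrable.
apply: (@le_trans _ _ (\int[mu]_(xi in `[- T, T]) (2 * C))).
  apply: le_Rintegral => //.
  - exact: integrable_norm (continuous_itv_integrable _ ci).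
  - by apply: continuous_itv_integrable => z; exact: cvg_cst.
  move=> xi _; apply: (le_trans (ler_normD _ _)); rewrite !normrM.
  have -> : 2 * C = C * 1 + C * 1 by ring.
  by rewrite lerD// ler_pM// ?cos_max ?sin_max.
rewrite Rintegral_cst//= lebesgue_measure_itv/= lte_fin ifT; last by lra.
by rewrite /= [leRHS](_ : _ = 2 * C * (T - - T))//; ring.
Qed.

Lemma continuous_mulid F : continuous F -> continuous (fun xi : R => xi * F xi).
Proof. by move=> cF x; apply: cvgM; [exact: cvg_id|exact: cF]. Qed.

Section DerivativeUnderIntegral.
Variables (T : R) (F G : R -> R).
Hypotheses (cF : continuous F) (cG : continuous G).

Let integrand (x xi : R) := F xi * cos (x * xi) + G xi * sin (x * xi).
Let dom (xi : R) := `|xi * F xi| + `|xi * G xi|.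

Let partial_integrand x xi : partial1of2 integrand x xi =
  xi * G xi * cos (x * xi) + - (xi * F xi) * sin (x * xi).
Proof.
rewrite partial1of2E /integrand derive_val /GRing.scale/=; ring.
Qed.

Let derivable_integrand x xi : derivable (integrand ^~ xi) x 1.
Proof. exact: ex_derive. Qed.

Let integrable_integrand x : mu.-integrable `[- T, T] (EFin \o integrand x).
Proof. by apply: continuous_itv_integrable; exact: continuous_trig. Qed.

Let integrable_dom : mu.-integrable `[- T, T] (EFin \o dom).
Proof.
apply: continuous_itv_integrable => z; apply: cvgD.
  by apply: cvg_norm; exact: (continuous_mulid cF).
by apply: cvg_norm; exact: (continuous_mulid cG).
Qed.

Let partial_le_dom x xi : `|partial1of2 integrand x xi| <= dom xi.
Proof.
rewrite partial_integrand (le_trans (ler_normD _ _))// addrC normrM.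
rewrite [`|_ * cos _|]normrM normrN /dom lerD//.
  by rewrite ler_piMr// sin_max.
by rewrite ler_piMr// cos_max.
Qed.

Let mem_unit_itv x : `]x - 1, x + 1[%classic x.
Proof. by rewrite /= in_itv/= ltrBlDr ltrDl ltr01. Qed.

(** The derivative in x multiplies F + i G by - i xi; [dom] bounds it independently of x, which
    permits differentiation under the integral. *)
Lemma derive1_trig_integral : derive1 (trig_integral T F G) =
  trig_integral T (fun xi => xi * G xi) (\- (fun xi => xi * F xi)).
Proof.
apply/funext => x.
rewrite (@differentiation_under_integral R _ _ mu integrand `[- T, T] _ x (x - 1) (x + 1)
  (mem_unit_itv x) _ _ dom) => //; last by move=> y; rewrite /dom addr_ge0.
by apply: eq_Rintegral => xi _; exact: partial_integrand.
Qed.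

End DerivativeUnderIntegral.

Lemma derivable_continuous F : (forall x, derivable F x 1) -> continuous F.
Proof. by move=> dF x; apply: differentiable_continuous; apply/derivable1_diffP. Qed.

(** The derivative of [H] is the difference of the two integrands, and [H] vanishes at - T and T
    because L < T. *)
Lemma trig_integral_by_parts L T F G x : 0 < T -> L < T ->
  (forall x, derivable F x 1) -> (forall x, derivable G x 1) ->
  continuous (derive1 F) -> continuous (derive1 G) ->
  (forall x, L < `|x| -> F x = 0) -> (forall x, L < `|x| -> G x = 0) ->
  trig_integral T (derive1 G) (\- derive1 F) x = x * trig_integral T F G x.
Proof.
move=> T0 LT dF dG cF' cG' FL GL.
have cF := derivable_continuous dF; have cG := derivable_continuous dG.
pose H xi := G xi * cos (x * xi) - F xi * sin (x * xi).
pose h1 xi := derive1 G xi * cos (x * xi) + (\- derive1 F) xi * sin (x * xi).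
pose h2 xi := F xi * cos (x * xi) + G xi * sin (x * xi).
have cF'N : continuous (\- derive1 F) by move=> z; apply: cvgN; exact: cF'.
have c1 : continuous h1 by exact: continuous_trig.
have c2 : continuous h2 by exact: continuous_trig.
have c12 : continuous (fun xi => h1 xi - x * h2 xi).
  move=> z; apply: cvgB; first exact: c1.
  by apply: cvgM; [exact: cvg_cst|exact: c2].
have dH (z : R) : is_derive z 1 H (h1 z - x * h2 z).
  have dFz : is_derive z 1 F (derive1 F z) by rewrite derive1E; exact/derivableP.
  have dGz : is_derive z 1 G (derive1 G z) by rewrite derive1E; exact/derivableP.
  rewrite /H; apply: is_derive_eq; rewrite /h1 /h2 /GRing.scale/=; ring.
have cH : continuous H by apply: derivable_continuous => z; exact: ex_derive.
have TT : - T < T by lra.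
have := @continuous_FTC2 _ (fun xi => h1 xi - x * h2 xi) H _ _ TT
  (continuous_subspaceT c12).
have -> : H T = 0.
  by rewrite /H FL ?GL ?mul0r ?subr0// gtr0_norm.
have -> : H (- T) = 0.
  by rewrite /H FL ?GL ?mul0r ?subr0// normrN gtr0_norm.
move=> H0; have {H0} /(congr1 fine) :
    (\int[mu]_(xi in `[(- T)%R, T]) (h1 xi - x * h2 xi)%:E = 0)%E.
  rewrite H0 ?sube0//.
  - split; first by move=> z _; exact: ex_derive.
    + by apply: cvg_at_right_filter; exact: cH.
    + by apply: cvg_at_left_filter; exact: cH.
  - by move=> z _; rewrite derive1E derive_val.
rewrite -[LHS]/(\int[mu]_(xi in `[- T, T]) (h1 xi - x * h2 xi)).
have i1 := continuous_itv_integrable T c1.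
have i2 := continuous_itv_integrable T c2.
rewrite RintegralB//; last by exact: eq_integrable (integrableZl _ x i2).
by rewrite RintegralZl//= => /eqP; rewrite subr_eq0 => /eqP.
Qed.

(** Each power of x is traded for one derivative of the pair. The induction runs over all [A], since
    a derivative is bounded by the shifted sequence. *)
Lemma trig_integral_decay L T A c F G k x : 0 < T -> L < T ->
  bounded_derivs L A c F -> bounded_derivs L A c G ->
  `|x| ^+ k * `|trig_integral T F G x| <= 4 * T * (c * A k).
Proof.
move=> T0 LT; elim: k A F G => [|k IH] A F G bF bG.
  have [[dF _ FA] [dG _ GA]] := (bF, bG).
  rewrite expr0 mul1r norm_trig_integral_le//.
  - exact: derivable_continuous (dF 0).
  - exact: derivable_continuous (dG 0).
  - by move=> xi; exact: (FA 0).
  - by move=> xi; exact: (GA 0).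
have [[dF FL _] [dG GL _]] := (bF, bG).
rewrite exprSr -mulrA -normrM -(trig_integral_by_parts x T0 LT)//.
- apply: (IH (fun n => A n.+1)); first exact: (bounded_derivs_derive1 bG).
  exact: (bounded_derivsN (bounded_derivs_derive1 bF)).
- exact: (dF 0).
- exact: (dG 0).
- exact: derivable_continuous (dF 1).
- exact: derivable_continuous (dG 1).
Qed.

(** Each derivative in x multiplies the pair by the variable, up to swap and sign, and so costs a
    factor L + 1 in [c]; once none are left, [trig_integral_decay] applies. *)
Lemma derive1n_trig_integral_decay L T A c F G n k x : 0 <= L -> 0 < T -> L < T ->
  0 <= c -> (forall n, n.+1%:R * A n <= A n.+1) ->
  bounded_derivs L A c F -> bounded_derivs L A c G ->
  `|x| ^+ k * `|derive1n n (trig_integral T F G) x| <= 4 * T * (c * (L + 1) ^+ n * A k).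
Proof.
move=> L0 T0 LT c0 AA; elim: n c c0 F G => [|n IH] c c0 F G bF bG.
  by rewrite expr0 mulr1; exact: (trig_integral_decay k x T0 LT bF bG).
have [[dF _ _] [dG _ _]] := (bF, bG).
rewrite derive1Sn derive1_trig_integral.
- have -> : c * (L + 1) ^+ n.+1 = c * (L + 1) * (L + 1) ^+ n by rewrite exprS mulrA.
  apply: IH.
  + by rewrite mulr_ge0// addr_ge0.
  + exact: bounded_derivs_mulid.
  + by apply: bounded_derivsN; exact: bounded_derivs_mulid.
- exact: derivable_continuous (dF 0).
- exact: derivable_continuous (dG 0).
Qed.

End TrigIntegral.

(** * Optimisation of the Gevrey weights *)

Section Optimisation.
Context {R : realType}.

Lemma leq_fact_expn n : (n`! <= n ^ n)%N.
Proof.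
elim: n => // n IH; rewrite factS expnS leq_mul2l /= (leq_trans IH)//.
by case: n {IH} => // n; rewrite leq_exp2r.
Qed.

Lemma lambertW_ge (w y : R) : 0 <= w -> w * expR w <= y -> w <= lambertW y.
Proof.
move=> w0 wy; have y0 : 0 <= y by apply: le_trans wy; rewrite mulr_ge0 ?expR_ge0.
have [W0 WE] := lambertWP y0; rewrite leNgt; apply/negP => Ww.
suff : lambertW y * expR (lambertW y) < w * expR w by rewrite WE ltNge wy.
apply: (@le_lt_trans _ _ (lambertW y * expR w)).
  by rewrite ler_wpM2l// ler_expR ltW.
by rewrite ltr_pM2r ?expR_gt0.
Qed.

(** With l = w exp(w), the quotient l^sigma / w is l^(sigma - 1) exp(w), and its power 1 / (sigma -
    1) is l exp(w / (sigma - 1)). *)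
Lemma decayE (sigma h x : R) : 1 < sigma -> 1 < `|x| ->
  decay sigma h x =
  expR (- (h * (ln `|x| * expR (lambertW (ln `|x|) / (sigma - 1))))).
Proof.
move=> s1 x1; have s0 : 0 < sigma - 1 by rewrite subr_gt0.
set l := ln `|x|; have l0 : 0 < l by rewrite ln_gt0.
have [] := lambertWP (ltW l0); rewrite -/l; set w := lambertW l => w0 wl.
have {}w0 : 0 < w.
  by rewrite lt_neqAle w0 andbT; apply/eqP => w00; move: l0; rewrite -wl -w00 mul0r ltxx.
rewrite /decay -/l -/w mulNr; congr (expR (- (h * _))).
have -> : l `^ sigma / w = l `^ (sigma - 1) * expR w.
  have -> : sigma = (sigma - 1) + 1 by rewrite subrK.
  rewrite powRD ?(gt_eqF l0) ?implybT// powRr1 ?ltW// addrK -mulrA; congr (_ * _).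
  by rewrite -{1}wl mulrAC divff ?mul1r// gt_eqF.
rewrite powRM ?powR_ge0 ?expR_ge0// -powRrM mulrC.
rewrite div1r divff ?gt_eqF// powRr1 ?ltW// mulrC; congr (_ * _).
by rewrite -expRM.
Qed.

(** With l = ln |x|, each of k!, h^(k^sigma) and M_k is at most exp(k l / 6), while the decay
    exponent is at most k l / 2, so together they stay below |x|^k = exp(k l). [tau] is chosen
    before [h], because [h] will come from the Gevrey estimate for that [tau]. *)
Lemma gevrey_weight_decay (sigma H : R) : 1 < sigma -> 0 < H ->
  exists2 tau : R, 0 < tau & forall h : R, 1 <= h ->
  exists2 r : R, 1 < r & forall x : R, r <= `|x| ->
  exists k : nat, k`!%:R * (h `^ (k%:R `^ sigma) * Mseq tau sigma k) <=
    `|x| ^+ k * decay sigma H x.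
Proof.
move=> s1 H0; pose s := sigma - 1.
have s0 : 0 < s by rewrite subr_gt0.
pose lam := 4 * H; have lam0 : 0 < lam by rewrite mulr_gt0.
have lams0 : 0 < lam `^ s by rewrite powR_gt0.
(* Chosen so that tau (lam^s exp(w)) (2 w / s) = w exp(w) / 6 = l / 6. *)
pose tau := s / (12 * lam `^ s).
have tau0 : 0 < tau by rewrite divr_gt0// mulr_gt0.
exists tau => // h h1.
have h0 : 0 < h by exact: lt_le_trans h1.
have lnh0 : 0 <= ln h by rewrite ln_ge0.
(* For k >= K the three summands give k >= 1, tau k^s >= 1 and ln h <= tau ln k. *)
pose K := 1 + tau^-1 `^ s^-1 + expR (ln h / tau).
have K1 : 1 <= K by rewrite /K -addrA lerDl addr_ge0 ?powR_ge0 ?expR_ge0.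
(* Once w >= w1, both 2 K <= lam exp(w / s) and ln lam <= w / s hold; |x| >= exp(w1 exp(w1)) forces
   w >= w1. *)
pose w1 := 1 + 2 * K * s / lam + s * `|ln lam|.
have w1_gt0 : 1 <= w1.
  rewrite /w1 -addrA lerDl addr_ge0//; last by rewrite mulr_ge0// ltW.
  by rewrite divr_ge0 ?ltW// mulr_gt0// mulr_gt0// (lt_le_trans ltr01).
have w10 : 0 <= w1 by rewrite (le_trans ler01).
exists (expR (w1 * expR w1)).
  by rewrite expR_gt1 mulr_gt0 ?expR_gt0// (lt_le_trans ltr01).
move=> x rx.
have x1 : 1 < `|x|.
  by apply: lt_le_trans rx; rewrite expR_gt1 mulr_gt0 ?expR_gt0// (lt_le_trans ltr01).
have x0 : 0 < `|x| by exact: lt_trans x1.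
rewrite decayE// -/s; set l := ln `|x|; set w := lambertW l.
have xE : `|x| = expR l by rewrite lnK// posrE.
have ll : w1 * expR w1 <= l by rewrite -[leLHS]expRK ler_ln// posrE expR_gt0.
have l0 : 0 < l by rewrite ln_gt0.
have wl : w * expR w = l by have [] := lambertWP (ltW l0).
have ww : w1 <= w by exact: lambertW_ge.
pose y := lam * expR (w / s).
have lnyE : ln y = ln lam + w / s by rewrite lnM ?posrE ?expR_gt0// expRK.
have y0 : 0 < y by rewrite mulr_gt0// expR_gt0.
have yK : 2 * K <= y.
  apply: (@le_trans _ _ (lam * (w / s))); last first.
    by rewrite ler_pM2l// (le_trans _ (expR_ge1Dx _))// lerDr.
  rewrite [leRHS]mulrC -ler_pdivrMr// ler_pdivlMr// (le_trans _ ww)// mulrAC.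
  have : 0 <= s * `|ln lam| by rewrite mulr_ge0// ltW.
  by rewrite /w1; lra.
have lnlam : ln lam <= w / s.
  rewrite ler_pdivlMr// (le_trans _ ww)// mulrC (@le_trans _ _ (s * `|ln lam|))//.
    by rewrite ler_pM2l// ler_norm.
  by rewrite /w1 lerDr addr_ge0// divr_ge0 ?ltW// !mulr_gt0// (lt_le_trans ltr01).
(* As y >= 2, truncation loses at most a factor 2: y / 2 <= k <= y. *)
pose k := Num.truncn y.
have /andP[ky yk] : k%:R <= y < k.+1%:R by rewrite truncn_itv// ltW.
have y2k : y <= 2 * k%:R by move: yk; rewrite -natr1; lra.
have Kk : K <= k%:R by lra.
have k0 : 0 < k%:R :> R by apply: lt_le_trans Kk; exact: lt_le_trans K1.
exists k.
have kn0 : (0 < k)%N by rewrite -(ltr0n R).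
pose P := k%:R `^ s.
have kP : k%:R `^ sigma = k%:R * P.
  have -> : sigma = 1 + s by rewrite addrC subrK.
  by rewrite powRD ?(gt_eqF k0) ?implybT// powRr1// ltW.
have lnk0 : 0 <= ln (k%:R : R) by rewrite ln_ge0// (le_trans K1).
have P0 : 0 <= P by exact: powR_ge0.
have tauP : 1 <= tau * P.
  rewrite mulrC -ler_pdivrMr// div1r.
  have -> : tau^-1 = (tau^-1 `^ s^-1) `^ s.
    by rewrite -powRrM mulVf ?gt_eqF// powRr1// invr_ge0 ltW.
  rewrite ge0_ler_powR ?nnegrE ?powR_ge0 ?(ltW s0) ?(ltW k0)//.
  rewrite (le_trans _ Kk)// /K addrAC lerDr.
  by rewrite addr_ge0 ?expR_ge0.
have lnhk : ln h <= tau * ln k%:R.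
  rewrite mulrC -ler_pdivrMr// -[leLHS]expRK ler_ln ?posrE ?expR_gt0//.
  by rewrite (le_trans _ Kk)// /K lerDr addr_ge0 ?powR_ge0.
have lnky : ln k%:R <= 2 * (w / s).
  by apply: (@le_trans _ _ (ln y)); [rewrite ler_ln|rewrite lnyE; lra].
have PE : P <= lam `^ s * expR w.
  apply: (@le_trans _ _ (y `^ s)).
    by rewrite ge0_ler_powR ?nnegrE ?(ltW s0) ?(ltW k0) ?(ltW y0).
  rewrite /y powRM ?expR_ge0 ?(ltW lam0)// ler_pM2l// -expRM.
  by rewrite divfK ?gt_eqF.
(* This is the exponent of M_k divided by k. It also dominates ln k, since tau P >= 1, and P ln h,
   since ln h <= tau ln k. *)
have main : tau * P * ln k%:R <= l / 6.
  apply: (@le_trans _ _ (tau * (lam `^ s * expR w) * (2 * (w / s)))).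
    by apply: ler_pM => //; [rewrite mulr_ge0// ltW|rewrite ler_pM2l].
  rewrite -wl /tau le_eqVlt; apply/orP; left; apply/eqP; field.
  by rewrite !gt_eqF.
have -> : Mseq tau sigma k = expR (tau * k%:R * P * ln k%:R).
  rewrite /Mseq -[k == _]negbK -lt0n kn0/= kP /powR.
  by rewrite (gt_eqF k0) mulrA.
have -> : h `^ (k%:R `^ sigma) = expR (k%:R * P * ln h).
  by rewrite kP /powR gt_eqF.
have kfact : k`!%:R <= expR (k%:R * ln k%:R) :> R.
  rewrite expRM_natl lnK ?posrE//.
  by rewrite -natrX ler_nat leq_fact_expn.
rewrite xE -expRM_natl -!expRD.
apply: (@le_trans _ _ (expR (k%:R * ln k%:R) *
   expR (k%:R * P * ln h + tau * k%:R * P * ln k%:R))).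
  by rewrite ler_wpM2r ?expR_ge0.
rewrite -expRD ler_expR.
have e1 : k%:R * ln k%:R <= k%:R * (l / 6).
  rewrite ler_pM2l// (le_trans _ main)//.
  by rewrite -[leLHS]mul1r ler_wpM2r.
have e2 : k%:R * P * ln h <= k%:R * (l / 6).
  rewrite -mulrA ler_pM2l// (le_trans _ main)//.
  by rewrite [tau * P]mulrC -mulrA ler_wpM2l.
have e3 : tau * k%:R * P * ln k%:R <= k%:R * (l / 6).
  have -> : tau * k%:R * P * ln k%:R = k%:R * (tau * P * ln k%:R) by ring.
  by rewrite ler_pM2l.
have e4 : H * (l * expR (w / s)) <= k%:R * l / 2.
  have -> : H * (l * expR (w / s)) = (l * y) / 4 by rewrite /y /lam; field.
  have := y2k; rewrite -(ler_pM2l l0); lra.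
lra.
Qed.

End Optimisation.

(** * From Gevrey bounds on the transform to decay of the function *)

Section Assembly.
Context {R : realType}.
Local Notation mu := (@lebesgue_measure R).

Lemma vanish_restrict (L T : R) (F : R -> R) : L < T ->
  (forall x, L < `|x| -> F x = 0) -> F \_ `[- T, T] = F.
Proof.
move=> LT FL; apply/funext => x; rewrite patchE; case: ifPn => //.
rewrite notin_setE/= in_itv/= -ler_norml => /negP; rewrite -ltNge => Tx.
by rewrite FL// (lt_trans LT).
Qed.

Lemma vanish_integrable (L T : R) (F : R -> R) : L < T -> continuous F ->
  (forall x, L < `|x| -> F x = 0) -> mu.-integrable setT (EFin \o F).
Proof.
move=> LT cF FL.
rewrite -(vanish_restrict LT FL) -restrict_EFin; apply: (integrable_mkcond _ _).1 => //.
exact: continuous_itv_integrable.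
Qed.

Lemma Rintegral_vanish (L T : R) (F : R -> R) : L < T ->
  (forall x, L < `|x| -> F x = 0) ->
  \int[mu]_x F x = \int[mu]_(x in `[- T, T]) F x.
Proof. by move=> LT FL; rewrite [RHS]Rintegral_mkcond (vanish_restrict LT FL). Qed.

Lemma Mseq_ge1 (tau sigma : R) n : 0 <= tau -> 1 <= Mseq tau sigma n.
Proof.
move=> t0; rewrite /Mseq; case: eqP => // /eqP n0.
have n1 : 1 <= n%:R :> R by rewrite ler1n lt0n.
by rewrite -[leLHS](powRr0 n%:R) ler_powR// mulr_ge0 ?powR_ge0.
Qed.

Lemma Mseq_leS (tau sigma : R) n : 0 <= tau -> 0 <= sigma ->
  Mseq tau sigma n <= Mseq tau sigma n.+1.
Proof.
move=> t0 s0; rewrite {1}/Mseq; case: eqP => [_|/eqP n0]; first exact: Mseq_ge1.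
have n1 : 1 <= n%:R :> R by rewrite ler1n lt0n.
rewrite /Mseq/=.
apply: (@le_trans _ _ (n%:R `^ (tau * n.+1%:R `^ sigma))).
  by rewrite ler_powR// ler_wpM2l// ge0_ler_powR// ?nnegrE// ler_nat.
by rewrite ge0_ler_powR ?nnegrE// ?ler_nat// mulr_ge0 ?powR_ge0.
Qed.

Lemma supp_bounded (f : R -> R[i]) : compact (supp f) ->
  exists2 L : R, 0 <= L & forall x, L < `|x| -> f x = 0.
Proof.
(* Every number above [M] bounds the support, hence the + 1; the maximum with 0 makes the bound
   nonnegative. *)
move=> /compact_bounded[M [_ HM]]; exists (Num.max 0 M + 1).
  by rewrite addr_ge0// le_max lexx.
move=> x xM; apply/eqP; apply: contraT => fx.
have sx : supp f x by apply: subset_closure.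
have MM : M < Num.max 0 M + 1 by rewrite ltr_pwDr// le_max lexx orbT.
have xM' : `|x| <= Num.max 0 M + 1 by exact: HM MM x sx.
by move: xM; rewrite ltNge xM'.
Qed.

Lemma derive1nMl (c : R) (f : R -> R) n : (forall n x, derivable (derive1n n f) x 1) ->
  derive1n n (fun x => c * f x) = (fun x => c * derive1n n f x).
Proof.
move=> df; elim: n => // n IH; rewrite derive1nS IH; apply/funext => x.
by rewrite derive1Ml// derive1nS.
Qed.

Lemma smooth_parts (f : R -> R[i]) : smooth f ->
  (forall n x, derivable (derive1n n (Rpart f)) x 1) /\
  (forall n x, derivable (derive1n n (Ipart f)) x 1).
Proof. by move=> sf; split => n x; have [] := sf n x. Qed.

Lemma normc_le (z : R[i]) : cmod z <= `|complex.Re z| + `|complex.Im z|.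
Proof.
case: z => a b /=; rewrite -[leRHS]ger0_norm ?addr_ge0// -sqrtr_sqr ler_wsqrtr//.
rewrite sqrrD !real_normK ?num_real// -addrA lerD2l lerDr.
by rewrite mulrn_wge0// mulr_ge0.
Qed.

(** The Gevrey bound on [- L, L] is weakened on purpose: the factor n! and the replacement of h by
    max(1, h) yield a sequence with (n + 1) A_n <= A_(n+1). *)
Lemma gevrey_bounded_derivs (tau sigma : R) (f : R -> R[i]) :
  0 <= tau -> 0 <= sigma -> D_roumieu tau sigma f ->
  exists L c h : R, [/\ 0 <= L, 0 <= c, 1 <= h,
    bounded_derivs L
      (fun n => n`!%:R * (h `^ (n%:R `^ sigma) * Mseq tau sigma n)) c (Rpart f) &
    bounded_derivs L
      (fun n => n`!%:R * (h `^ (n%:R `^ sigma) * Mseq tau sigma n)) c (Ipart f)].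
Proof.
move=> t0 s0 [[sf bf] /supp_bounded[L L0 fL]].
have [C [h [C0 h0 HC]]] := bf _ (segment_compact (a := - L) (b := L)).
have [dr di] := smooth_parts sf.
pose h' := Num.max 1 h; have h1 : 1 <= h' by rewrite le_max lexx.
have H n x : `|x| <= L -> cmod (cderiv n f x) <=
    C * (n`!%:R * (h' `^ (n%:R `^ sigma) * Mseq tau sigma n)).
  move=> xL; have := HC x n; rewrite /= in_itv/= -ler_norml => /(_ xL).
  move=> /le_trans; apply; rewrite -mulrA ler_pM2l//.
  have M0 : 0 <= Mseq tau sigma n by rewrite (le_trans ler01)// Mseq_ge1.
  apply: (@le_trans _ _ (h' `^ (n%:R `^ sigma) * Mseq tau sigma n)).
    rewrite ler_wpM2r// ge0_ler_powR ?powR_ge0 ?nnegrE ?(ltW h0)//.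
      by rewrite (le_trans ler01).
    by rewrite le_max lexx orbT.
  by rewrite ler_peMl ?mulr_ge0 ?powR_ge0// ler1n fact_gt0.
have A0 n : 0 <= C * (n`!%:R * (h' `^ (n%:R `^ sigma) * Mseq tau sigma n)).
  have : `|0 : R| <= L by rewrite normr0.
  by move=> /(H n); apply: le_trans; case: (cderiv n f 0) => a b; exact: sqrtr_ge0.
exists L, C, h'; split => //; first exact: ltW.
- have rL x : L < `|x| -> complex.Re (f x) = 0 by move=> /fL ->.
  split=> // n x; have [Lx|xL] := ltP L `|x|.
    by rewrite (derive1n_vanish _ rL)// normr0.
  by apply: le_trans (H n x xL); exact: (le_Re_normc (cderiv n f x)).
- have iL x : L < `|x| -> complex.Im (f x) = 0 by move=> /fL ->.
  split=> // n x; have [Lx|xL] := ltP L `|x|.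
    by rewrite (derive1n_vanish _ iL)// normr0.
  by apply: le_trans (H n x xL); exact: (le_Im_normc (cderiv n f x)).
Qed.

Lemma weight_leS (h tau sigma : R) n : 1 <= h -> 0 <= tau -> 0 <= sigma ->
  n.+1%:R * (n`!%:R * (h `^ (n%:R `^ sigma) * Mseq tau sigma n)) <=
  n.+1`!%:R * (h `^ (n.+1%:R `^ sigma) * Mseq tau sigma n.+1).
Proof.
move=> h1 t0 s0; rewrite factS natrM mulrA ler_wpM2l//.
apply: ler_pM; rewrite ?powR_ge0//.
- by rewrite (le_trans ler01)// Mseq_ge1.
- by rewrite ler_powR// ge0_ler_powR ?nnegrE// ler_nat.
- exact: Mseq_leS.
Qed.

(** The rate [h] fixes [tau], the Gevrey bound on [g] for this [tau] fixes [h'], and [h'] fixes the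
    radius [r]. None of them depends on [n], which enters only through (L + 1)^n. *)
Lemma fourier_gevrey_decay (sigma : R) (f g : R -> R[i]) : 1 < sigma ->
  smooth f -> is_fourier_L2 f g -> D_sigma sigma g ->
  forall h : R, 0 < h -> exists C r : R, [/\ 1 <= C, 1 < r &
    forall (n : nat) (x : R), r <= `|x| ->
      cmod (cderiv n f x) <= C ^+ n.+1 * decay sigma h x].
Proof.
move=> s1 sf fg Dg h h0.
have s0 : 0 <= sigma by rewrite (le_trans ler01)// ltW.
have [tau tau0 Htau] := gevrey_weight_decay s1 h0.
have [L [c [h' [L0 c0 h'1 bR bI]]]] := gevrey_bounded_derivs (ltW tau0) s0 (Dg _ tau0).
have [r r1 Hr] := Htau h' h'1.
pose A n := n`!%:R * (h' `^ (n%:R `^ sigma) * Mseq tau sigma n).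
have AA n : n.+1%:R * A n <= A n.+1 by exact: weight_leS (ltW tau0) s0.
pose T := L + 1; have LT : L < T by rewrite ltrDl.
have T0 : 0 < T by exact: le_lt_trans LT.
have [dfr dfi] := smooth_parts sf.
have [[dgr grL _] [dgi giL _]] := (bR, bI).
have cgr := derivable_continuous (dgr 0).
have cgi := derivable_continuous (dgi 0).
have cfr := derivable_continuous (dfr 0).
have cfi := derivable_continuous (dfi 0).
have igr := vanish_integrable LT cgr grL.
have igi := vanish_integrable LT cgi giL.
have inv y := fourier_L2_inversion fg (cfr y) (cfi y) igr igi grL giL.
have rE : (fun y => 2 * pi * complex.Re (f y)) = trig_integral T (Rpart g) (Ipart g).
  apply/funext => y; rewrite (inv y).1 (Rintegral_vanish LT)// => xi Lxi.
  by rewrite grL// giL// !mul0r addr0.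
have iE : (fun y => 2 * pi * complex.Im (f y)) = trig_integral T (Ipart g) (\- Rpart g).
  apply/funext => y; rewrite (inv y).2 (Rintegral_vanish LT).
    by apply: eq_Rintegral => xi _; rewrite mulNr.
  by move=> xi Lxi; rewrite grL// giL// !mul0r subr0.
have pi0 : 0 < pi :> R by exact: pi_gt0.
have bound (F G : R -> R) (u : R -> R) : (forall n x, derivable (derive1n n u) x 1) ->
    bounded_derivs L A c F -> bounded_derivs L A c G ->
    (fun y => 2 * pi * u y) = trig_integral T F G -> forall n x, r <= `|x| ->
    `|derive1n n u x| <= 2 * T * c / pi * (L + 1) ^+ n * decay sigma h x.
  (* The exponent [k] is adapted to x alone; the bound on |x|^k times the derivative is then divided
     by |x|^k. *)
  move=> du bF bG uE n x rx; have [k Hk] := Hr x rx.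
  have x0 : 0 < `|x| ^+ k by rewrite exprn_gt0// (lt_le_trans _ rx)// (lt_trans ltr01).
  have := derive1n_trig_integral_decay n k x L0 T0 LT c0 AA bF bG.
  rewrite -uE derive1nMl// normrM [`|2 * pi|]gtr0_norm ?mulr_gt0// => H.
  rewrite -(ler_pM2l x0) -(ler_pM2l (mulr_gt0 (ltr0Sn R 1) pi0)).
  have -> : 2 * pi * (`|x| ^+ k * `|derive1n n u x|) =
    `|x| ^+ k * (2 * pi * `|derive1n n u x|) by ring.
  apply: (le_trans H).
  apply: (@le_trans _ _ (4 * T * (c * (L + 1) ^+ n * (`|x| ^+ k * decay sigma h x)))).
    rewrite ler_wpM2l ?mulr_ge0 ?(ltW T0)// ler_wpM2l//.
    by rewrite mulr_ge0// exprn_ge0// addr_ge0.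
  have E (q d e p : R) : p != 0 -> 4 * T * (c * q * (d * e)) =
      2 * p * (d * (2 * T * c / p * q * e)) by move=> p0; field.
  by rewrite -E// gt_eqF.
(* The sum of the bounds for the two parts has constant B; 1 + B + L dominates both B and L + 1, so
   B (L + 1)^n is at most its power n + 1. *)
pose B := 4 * T * c / pi.
have B0 : 0 <= B by rewrite divr_ge0 ?mulr_ge0// ltW.
exists (1 + B + L), r; split => //; first by rewrite -addrA lerDl addr_ge0.
move=> n x rx; apply: (le_trans (normc_le _)).
have b1 := bound _ _ _ dfr bR bI rE n x rx.
have b2 := bound _ _ _ dfi bI (bounded_derivsN bR) iE n x rx.
apply: (le_trans (lerD b1 b2)).
have -> : 2 * T * c / pi * (L + 1) ^+ n * decay sigma h x +
  2 * T * c / pi * (L + 1) ^+ n * decay sigma h x = B * (L + 1) ^+ n * decay sigma h x.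
  by rewrite /B; ring.
rewrite ler_wpM2r ?expR_ge0// exprS ler_pM ?exprn_ge0 ?addr_ge0//.
  by rewrite addrAC lerDr addr_ge0.
by rewrite lerXn2r ?nnegrE ?addr_ge0// addrAC [L + 1]addrC lerDl.
Qed.

End Assembly.

Unset Implicit Arguments.

Theorem theorem3p7 (R : realType) (sigma a : R) (phia phi2a : R -> R)
    (psi psihat : R -> R[i]) :
  1 < sigma ->
  0 < a < pi / 3 ->
  phi_admissible sigma a phia ->
  phi_admissible sigma (2 * a) phi2a ->
  smooth psi ->
  orthonormal_wavelet psi ->
  is_fourier_L2 psi psihat ->
  D_sigma sigma psihat ->
  (forall xi : R, psihat xi = cexpi (xi / 2) * (bell phia phi2a xi)%:C) ->
  (forall (n : nat) (h : R), 0 < h ->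
     exists C r : R, [/\ 0 < C, 1 < r &
       forall x : R, r <= `|x| ->
         cmod (cderiv n psi x) <= C * decay sigma h x]) /\
  (forall h : R, 0 < h ->
     exists C r : R, [/\ 0 < C, 1 < r &
       forall (s : R) (n : nat) (x : R), 0 < s <= 1 -> r <= `|x| ->
         cmod (cderiv n psi x) <=
           C ^+ n.+1 * (n`!%:R) `^ s * decay sigma h x]).
Proof.
move=> s1 _ _ _ spsi _ Fpsi Dpsi _.
(* A bound C^(n+1) with [r] uniform in n gives both estimates: for fixed n the power is a constant,
   and n!^s >= 1 for s > 0. *)
have main := fourier_gevrey_decay s1 spsi Fpsi Dpsi.
split=> [n h h0|h h0]; have [C [r [C1 r1 H]]] := main h h0.
  exists (C ^+ n.+1), r; split => // [|x rx]; last exact: H.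
  by rewrite exprn_gt0// (lt_le_trans ltr01).
exists C, r; split => // [|s n x /andP[s0 _] rx]; first by rewrite (lt_le_trans ltr01).
apply: (le_trans (H n x rx)); rewrite ler_wpM2r ?expR_ge0//.
rewrite ler_peMr ?exprn_ge0 ?(le_trans ler01)//.
by rewrite -[leLHS](powRr0 n`!%:R) ler_powR ?(ltW s0)// ler1n fact_gt0.
Qed.
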